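(* For every real number $c<-\tfrac{3}{2}$, the bounded component $\Sigma_c^b$ of the energy hypersurface of the planar rotating Kepler problem admits a 2-to-1 symplectic strictly convex embedding into $(\mathbb{R}^4,\omega_0)$, whose image extends smoothly over the set of collisions to a closed strictly convex hypersurface in $\mathbb{R}^4$. Explicitly: for every $c<-\tfrac32$ there exist a closed strictly convex smooth hypersurface $S\subset\mathbb{R}^4$, a closed nowhere dense subset $C\subset S$ (the set of collisions), and a smooth 2-to-1 covering map $$f\colon S\setminus C\to \Sigma_c^b$$ such that (i) $f$ is symplectic, i.e. $f^*(\omega|_{\Sigma_c^b})=\omega_0|_{S\setminus C}$; (ii) the points of $C$ correspond to collisions, i.e. if $(x_n)$ is a sequence in $S\setminus C$ converging to a point of $C$ and $f(x_n)=(q_n,p_n)$, then $q_n\to 0$.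
   Context: The planar rotating Kepler problem is the Hamiltonian system on $T^*(\mathbb{R}^2\setminus\{0\})=(\mathbb{R}^2\setminus\{0\})\times\mathbb{R}^2$, with coordinates $(q,p)=(q_1,q_2,p_1,p_2)$ and canonical symplectic form $\omega=dp_1\wedge dq_1+dp_2\wedge dq_2$, given by $$H(q,p)=\frac{\|p\|^2}{2}-\frac{1}{\|q\|}+(p_1q_2-p_2q_1)=\frac12\Big((p_1+q_2)^2+(p_2-q_1)^2\Big)+U(q),$$ where $U(q)=-\frac{1}{\|q\|}-\frac{\|q\|^2}{2}$ is the effective potential. The only critical value of $U$ (equivalently of $H$) is $-\frac32$. For $c\in\mathbb{R}$ let $\Sigma_c=H^{-1}(c)$, and let $\mathcal{K}_c=\{q\in\mathbb{R}^2\setminus\{0\}: U(q)\le c\}$ be the Hill's region, which is the image of $\Sigma_c$ under $(q,p)\mapsto q$. For $c<-\frac32$ the set $\mathcal{K}_c$ has exactly two connected components, one bounded, $\mathcal{K}_c^b$, and one unbounded, $\mathcal{K}_c^u$. Put $\Sigma_c^b=\{(q,p)\in\Sigma_c: q\in\mathcal{K}_c^b\}$. This is a connected, non-compact smooth hypersurface; its non-compactness is due to collisions ($q\to 0$). $\mathbb{R}^4$ carries its standard symplectic form $\omega_0=dy_1\wedge dx_1+dy_2\wedge dx_2$ in coordinates $(x_1,x_2,y_1,y_2)$. A closed strictly convex hypersurface in $\mathbb{R}^4$ is a compact connected smooth embedded hypersurface without boundary which bounds a convex domain and whose Gauss-Kronecker curvature is everywhere positive (equivalently, its second fundamental form with respect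 to the inward normal is everywhere positive definite). The notation $\omega|_{\Sigma}$ means the pull-back of the 2-form $\omega$ to the submanifold $\Sigma$ under inclusion. ''2-to-1'' means that every point of the target has exactly two preimages. *)

(* Defs.v *)
From HB Require Import structures.
From mathcomp Require Import all_boot all_order all_algebra.
From mathcomp Require Import all_classical all_reals all_analysis.

Set Implicit Arguments.
Unset Strict Implicit.
Unset Printing Implicit Defensive.

Import Order.TTheory GRing.Theory Num.Theory.
Import numFieldNormedType.Exports.

Local Open Scope classical_set_scope.
Local Open Scope ring_scope.

Section Smoothness.
Variables (R : realType) (V W : normedModType R).

(* For finite-dimensional V this is the usual C^k class on an open set U. *)
Fixpoint Ck_on (k : nat) (U : set V) (f : V -> W) : Prop :=
  if k is k'.+1 then
    (forall x, U x -> differentiable f x) /\ (forall v, Ck_on k' U ('D_v f))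
  else forall x, U x -> {for x, continuous f}.

Definition smooth_on (U : set V) (f : V -> W) : Prop :=
  forall k, Ck_on k U f.

(* Smoothness on an arbitrary subset (e.g. a submanifold): f is locally the
   restriction of a smooth map defined on an open set of the ambient space;
   the values of f outside A are irrelevant. *)
Definition smooth_map (A : set V) (f : V -> W) : Prop :=
  forall x, A x -> exists (U : set V) (g : V -> W),
    [/\ open U, U x, smooth_on U g & forall z, A z -> U z -> g z = f z].

End Smoothness.

Section Submanifolds.
Variables (R : realType) (n : nat).
Notation E := 'rV[R]_n.+1.

(* The norm `|_| of the library on row vectors is the sup norm. *)
Definition dot (u v : E) : R := \sum_i u 0 i * v 0 i.
Definition enorm (u : E) : R := Num.sqrt (dot u u).

Definition grad (F : E -> R) (x : E) : E :=
  \row_i 'D_(delta_mx 0 i) F x.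

Definition local_equation (S U : set E) (F : E -> R) : Prop :=
  [/\ open U, smooth_on U F,
      S `&` U = [set z | U z /\ F z = 0] &
      forall z, (S `&` U) z -> grad F z != 0].

Definition smooth_hypersurface (S : set E) : Prop :=
  forall x, S x -> exists (U : set E) (F : E -> R), U x /\ local_equation S U F.

Definition curve_in (M : set E) (x : E) (gamma : R -> E) : Prop :=
  gamma 0 = x /\ exists I : set R,
    [/\ open I, I 0, smooth_on I gamma & forall t, I t -> M (gamma t)].

Definition tangent (M : set E) (x : E) : set E :=
  [set v | exists2 gamma, curve_in M x gamma & derive1 gamma 0 = v].

(* The unit normal of the level sets of F pointing towards {F < 0}. *)
Definition unit_normal (F : E -> R) (x : E) : E :=
  - ((enorm (grad F x))^-1 *: grad F x).

(* II(u, v) = - <D_u N, v>: with N the inward normal, the unit sphere has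
   II = <_, _>. *)
Definition second_fundamental_form (F : E -> R) (x u v : E) : R :=
  - dot ('D_u (unit_normal F) x) v.

(* S bounds the convex domain K; near each point K is given by F < 0, so that
   unit_normal F is the inward normal. *)
Definition closed_strictly_convex_hypersurface (S : set E) : Prop :=
  [/\ compact S, connected S, smooth_hypersurface S &
      exists K : set E,
        [/\ open K, K !=set0, bounded_set K,
            convex_set (K : set (convex_lmodType E)) & S = closure K `\` K] /\
        forall x, S x -> exists (U : set E) (F : E -> R),
          [/\ U x, local_equation S U F,
              K `&` U = [set z | U z /\ F z < 0] &
              forall v, tangent S x v -> v != 0 ->
                0 < second_fundamental_form F x v v]].

Definition nowhere_dense_in (C S : set E) : Prop :=
  forall U : set E, open U -> S `&` U !=set0 -> ~ (S `&` U `<=` closure C).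

Definition diffeomorphism (A B : set E) (f : E -> E) : Prop :=
  [/\ set_bij A B f, smooth_map A f &
      exists2 g : E -> E, smooth_map B g & forall x, A x -> g (f x) = x].

(* V and the W i are open in the ambient space, so that N `&` V and the
   M `&` W i are relatively open in N and M. *)
Definition smooth_covering (M N : set E) (f : E -> E) : Prop :=
  [/\ smooth_map M f, set_surj M N f, set_fun M N f &
      forall y, N y -> exists (V : set E) (I : Type) (W : I -> set E),
        [/\ open V /\ V y, forall i, open (W i),
            M `&` f @^-1` V = \bigcup_i (M `&` W i),
            trivIset setT (fun i => M `&` W i) &
            forall i, diffeomorphism (M `&` W i) (N `&` V) f]].

Definition two_to_one (M N : set E) (f : E -> E) : Prop :=
  forall y, N y -> (M `&` f @^-1` [set y] #= `I_2)%card.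

End Submanifolds.

Section RotatingKepler.
Variable R : realType.

(* A point of R^4 is row_mx q p with q (resp. x) and p (resp. y) in R^2. *)
Notation R4 := 'rV[R]_(2 + 2).

Definition pos (z : R4) : 'rV[R]_2 := lsubmx z.
Definition mom (z : R4) : 'rV[R]_2 := rsubmx z.

(* dp_1 /\ dq_1 + dp_2 /\ dq_2; this is also omega_0 in the coordinates
   (x_1, x_2, y_1, y_2). *)
Definition omega (u v : R4) : R :=
  \sum_i (mom u 0 i * pos v 0 i - pos u 0 i * mom v 0 i).

(* The curves run through all tangent vectors of M at x, and the velocity of
   f \o gamma is the image of that of gamma under the differential of f. *)
Definition symplectic_on (M : set R4) (f : R4 -> R4) : Prop :=
  forall (x : R4) (gamma delta : R -> R4),
    M x -> curve_in M x gamma -> curve_in M x delta ->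
    omega (derive1 (f \o gamma) 0) (derive1 (f \o delta) 0) =
    omega (derive1 gamma 0) (derive1 delta 0).

Definition hamiltonian (z : R4) : R :=
  let q := pos z in let p := mom z in
  enorm p ^+ 2 / 2 - (enorm q)^-1 + (p 0 0 * q 0 1 - p 0 1 * q 0 0).

Definition effective_potential (q : 'rV[R]_2) : R :=
  - (enorm q)^-1 - enorm q ^+ 2 / 2.

Definition energy_surface (c : R) : set R4 :=
  [set z | pos z != 0 /\ hamiltonian z = c].

Definition hill_region (c : R) : set 'rV[R]_2 :=
  [set q | q != 0 /\ effective_potential q <= c].

(* The union of the bounded connected components of the Hill's region; for
   c < -3/2 there is exactly one. *)
Definition bounded_hill_region (c : R) : set 'rV[R]_2 :=
  [set q | hill_region c q /\
           bounded_set (connected_component (hill_region c) q)].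

Definition bounded_energy_surface (c : R) : set R4 :=
  energy_surface c `&` pos @^-1` bounded_hill_region c.

End RotatingKepler.

(* Main.v *)
Require Import Defs.
From mathcomp Require Import all_boot all_order all_algebra.
From mathcomp Require Import all_classical all_reals all_analysis.
From mathcomp Require Import ring lra.

Set Implicit Arguments.
Unset Strict Implicit.
Unset Printing Implicit Defensive.

Import Order.TTheory GRing.Theory Num.Theory.
Import numFieldNormedType.Exports.

Local Open Scope classical_set_scope.
Local Open Scope ring_scope.

(** Identify R^2 with the complex plane, so that a point of R^4 is a pair (q, p)
or (x, y) of complex numbers, and write <.,.> for the scalar product of R^2 and
C for - c > 3/2. On the source R^4 put
<<
  L = (|x|^2 + |y|^2) / 4,      J = (x1 y2 - x2 y1) / 2.
>>
The regularizing map is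
<<
  f (x, y) = (e^(it) u, e^(it) w)   with   u = L x^2 / 2,
             w = x y / (L |x|^2),          t = L^2 <x, y> / 2,
>>
that is, the Levi-Civita square map, preceded by the dilation
(x, y) |-> (sqrt L x, y / sqrt L), which turns all the regularized energy levels
of the Kepler problem into round spheres, and followed by a rotation. Away from
x = 0 it carries the Kepler energy |p|^2 / 2 - 1 / |q| back to - 1 / (2 L^2) and
the angular momentum back to J, hence the Hamiltonian back to
- 1 / (2 L^2) - J. The hypersurface S is the part L < 1 of the level set
J = C - 1 / (2 L^2), which is smooth across the collisions x = 0 and invariant
under a torus of rotations.

Symplecticity ([regularization_symplectic]). The Liouville form p dq pulls
back to y dx + <x, y> dL / (2 L) + J dt: the second term is due to the
dilation, the third to the rotation. On S one has dJ = dL / L^3, so that J dt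
is - t dL / L^3 up to an exact form, and the choice of t makes the two terms
in dL cancel. The map f is symplectic on S only, not on R^4; in return it is
explicit. It differs from the lift of the map of Ligon and Schaaf, which is
symplectic everywhere but in which Kepler's equation has to be solved, by a
displacement along the Hamiltonian flow on S, and such a displacement does not
change the restriction of the symplectic form.

Covering ([lift_spec], [regularization_covering], [regularization_two_to_one]).
From (q, p) one recovers L = (2 / |q| - |p|^2)^(-1/2), t = L^2 <q, p>,
x^2 = 2 e^(-it) q / L and y = L e^(-it) p conj(x). A point therefore has as
many preimages as its x^2 has square roots, and the branches of the square
root are the smooth local inverses. That the bounded component |q| < 1
corresponds to the part L < 1 follows from J^2 <= |q|^2 |p|^2
([radius_lt1]).

Convexity ([ddenergy_gt0], [domain_convex]). S is the boundary of
K = {L < 1, F < 0} for the polynomial F = (C - J) L^2 - 1/2, which decreases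
strictly along the rays of K towards the origin. The second derivative of F
along every nonzero tangent vector of S is positive; the inequality behind
this degenerates as C and L tend to 3/2 and 1. Now shrink a segment
with end points in K towards the origin. If it is not contained in K from the
start, there is a last moment at which it touches S. It does so at an interior
point of the segment, where the restriction of F has a maximum: its first
derivative vanishes there and its second derivative is not positive, which
contradicts the positivity just stated. *)

(** * Smooth functions on a normed space *)

Section SmoothCalculus.
Variables (R : realType) (V : normedModType R).
Implicit Types (U : set V) (x v : V).

(** The difference of the two functions vanishes near x, so the zero map is
a differential for it. *)
Lemma near_eq_differentiable (W : normedModType R) (f g : V -> W) x :
  (\near x, f x = g x) -> differentiable f x -> differentiable g x.
Proof.
move=> fg df.
suff dh : differentiable (g - f) x.
  by rewrite -[g](subrK f); apply: differentiableD.
have gf0 : (g - f) x = 0.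
  by rewrite -[LHS]/(g x - f x) (nbhs_singleton fg) subrr.
have E : (fun y => g y - f y) =o_ x (fun y => y - x).
  apply/eqoP => e e0.
  apply: filterS fg => h fgh.
  by rewrite fgh subrr normr0 mulr_ge0 // ltW.
apply/diffP => /=.
apply: (@getPex _ (fun (df : {linear V -> W}) => continuous df /\
  forall y, (g - f) y = (g - f) (lim (nbhs x)) + df (y - lim (nbhs x))
                  +o_(y \near x) (y - lim (nbhs x)))).
exists (\0 : {linear V -> W}); split; first exact: cst_continuous.
rewrite lim_id// gf0; apply: eqaddoEx => z; rewrite addr0 add0r.
by rewrite -[LHS]/((fun y => g y - f y) z) [LHS](congr1 (@^~ z) E).
Qed.

Lemma Ck_eq (W : normedModType R) k U (f g : V -> W) :
  open U -> (forall x, U x -> f x = g x) -> Ck_on k U f -> Ck_on k U g.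
Proof.
move=> oU; elim: k f g => [|k IH] f g fg /=.
  move=> cf x Ux; have := cf x Ux; rewrite /prop_for /continuous_at => cfx.
  rewrite -(fg _ Ux); apply: cvg_trans cfx; apply: near_eq_cvg.
  by have := open_nbhs_nbhs (conj oU Ux); apply: filterS => z /fg.
move=> [df Cf]; split.
  move=> x Ux; have nfg : \near x, f x = g x.
    by have := open_nbhs_nbhs (conj oU Ux); apply: filterS => z /fg.
  exact: near_eq_differentiable nfg (df x Ux).
move=> v; apply: IH (Cf v) => x Ux; apply: near_eq_derive.
by have := open_nbhs_nbhs (conj oU Ux); apply: filterS => z /fg.
Qed.

Lemma Ck_le (W : normedModType R) k U (f : V -> W) :
  Ck_on k.+1 U f -> Ck_on k U f.
Proof.
elim: k f => [|k IH] f [df Cf].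
  by move=> x Ux; apply/differentiable_continuous/df.
by split => // v; apply: IH.
Qed.

Lemma Ck_cst (W : normedModType R) k U (a : W) : open U -> Ck_on k U (cst a).
Proof.
elim: k a => [|k IH] a oU; first by move=> x _; exact: cst_continuous.
split=> [x _|v]; first exact: differentiable_cst.
have -> : 'D_v (cst a : V -> W) = cst 0 by apply/funext => x; rewrite derive_cst.
exact: IH.
Qed.

Lemma CkD (W : normedModType R) k U (f g : V -> W) : open U ->
  Ck_on k U f -> Ck_on k U g -> Ck_on k U (fun x => f x + g x).
Proof.
move=> oU; elim: k f g => [|k IH] f g.
  by move=> cf cg x Ux; apply: cvgD; [exact: cf | exact: cg].
move=> [df Cf] [dg Cg]; split=> [x Ux|v].
  by apply: differentiableD; [exact: df|exact: dg].
apply: (@Ck_eq _ _ _ (fun x => 'D_v f x + 'D_v g x)) => //.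
  move=> x Ux; rewrite [RHS]deriveD //; apply: diff_derivable; [exact: df|exact: dg].
exact: (IH _ _ (Cf v) (Cg v)).
Qed.

Lemma CkZ (W : normedModType R) k U (f : V -> R) (w : W) : open U ->
  Ck_on k U f -> Ck_on k U (fun x => f x *: w).
Proof.
move=> oU; elim: k f => [|k IH] f.
  by move=> cf x Ux; apply: cvgZr_tmp; exact: cf.
move=> [df Cf]; split=> [x Ux|v]; first exact/differentiableZl/df.
apply: (@Ck_eq _ _ _ (fun x => 'D_v f x *: w)) => //; last exact: (IH _ (Cf v)).
move=> x Ux; have dfx := df x Ux.
by rewrite !deriveE ?diffZl//; exact: differentiableZl.
Qed.

Lemma CkM k U (f g : V -> R) : open U ->
  Ck_on k U f -> Ck_on k U g -> Ck_on k U (fun x => f x * g x).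
Proof.
move=> oU; elim: k f g => [|k IH] f g.
  by move=> cf cg x Ux; apply: cvgM; [exact: cf | exact: cg].
move=> Cf' Cg'; have [df Cf] := Cf'; have [dg Cg] := Cg'.
split=> [x Ux|v].
  by apply: differentiableM; [exact: df|exact: dg].
apply: (@Ck_eq _ _ _ (fun x => f x * 'D_v g x + g x * 'D_v f x)) => //.
  move=> x Ux; rewrite [RHS]deriveM //; apply: diff_derivable; [exact: df|exact: dg].
by apply: CkD => //; [apply: (IH _ _ _ (Cg v)) | apply: (IH _ _ _ (Cf v))];
  exact: Ck_le.
Qed.

Lemma derive_comp1 (f : V -> R) (phi : R -> R) (d : R) x v :
  differentiable f x -> is_derive (f x) 1 phi d ->
  'D_v (phi \o f) x = d * 'D_v f x.
Proof.
move=> df [dphi phid].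
have dphi' : differentiable phi (f x) by exact/derivable1_diffP.
rewrite [LHS]deriveE; last exact: differentiable_comp.
rewrite (diff_comp df dphi') /= (deriveE _ df).
by rewrite (deriv1E dphi) /= derive1E phid mulrC.
Qed.

(** The induction step of the closure of C^k under composition with phi. Inverse,
square root, cosine and sine all have a derivative that is again an expression
in the same functions, which closes the induction for each of them. *)
Lemma Ck_comp1 k U (f : V -> R) (phi dphi : R -> R) : open U ->
  (forall x, U x -> is_derive (f x) 1 phi (dphi (f x))) ->
  Ck_on k.+1 U f -> Ck_on k U (dphi \o f) -> Ck_on k.+1 U (phi \o f).
Proof.
move=> oU dp [df Cf] Cphi; split=> [x Ux|v].
  apply: differentiable_comp; first exact: df.
  by have [? _] := dp x Ux; exact/derivable1_diffP.
apply: (@Ck_eq _ _ _ (fun x => (dphi \o f) x * 'D_v f x)) => //.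
  by move=> x Ux /=; rewrite (derive_comp1 _ (df _ Ux) (dp _ Ux)).
exact: CkM (Cf v).
Qed.

Lemma CkN k U (f : V -> R) : open U ->
  Ck_on k U f -> Ck_on k U (fun x => - f x).
Proof.
move=> oU Cf; apply: (@Ck_eq _ _ _ (fun x => (-1) * f x)) => //.
  by move=> x _; rewrite mulN1r.
exact: CkM (Ck_cst _ _ _) Cf.
Qed.

Lemma CkV k U (f : V -> R) : open U -> (forall x, U x -> f x != 0) ->
  Ck_on k U f -> Ck_on k U (fun x => (f x)^-1).
Proof.
move=> oU f0; elim: k => [|k IH] Cf.
  by move=> x Ux; apply: cvgV; [exact: f0|exact: Cf].
apply: (@Ck_comp1 k U f GRing.inv (fun y => - y ^- 2)) => // [x Ux|].
  have := @is_deriveV R id (f x) 1 1 (f0 x Ux) (is_derive_id _ _).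
  by rewrite [_ *: _]mulr1.
have Ci := IH (Ck_le Cf).
apply: (@Ck_eq _ _ _ (fun x => - ((f x)^-1 * (f x)^-1))) => //.
  by move=> x Ux /=; rewrite -invfM -expr2.
exact/CkN/CkM.
Qed.

Lemma Ck_sqrt k U (f : V -> R) : open U -> (forall x, U x -> 0 < f x) ->
  Ck_on k U f -> Ck_on k U (fun x => Num.sqrt (f x)).
Proof.
move=> oU f0; elim: k => [|k IH] Cf.
  by move=> x Ux; apply: continuous_comp; [exact: Cf|exact: sqrt_continuous].
apply: (@Ck_comp1 k U f Num.sqrt (fun y => (2 * Num.sqrt y)^-1)) => // [x Ux|].
  exact/is_derive1_sqrt/f0.
apply: CkV => // [x Ux|]; first by rewrite mulf_neq0 // sqrtr_eq0 -ltNge f0.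
by apply: CkM => //; [exact: Ck_cst|exact/IH/Ck_le].
Qed.

(** The two functions are treated together since each is the derivative of the
other up to sign. *)
Lemma Ck_cos_sin k U (f : V -> R) : open U -> Ck_on k U f ->
  Ck_on k U (fun x => cos (f x)) /\ Ck_on k U (fun x => sin (f x)).
Proof.
move=> oU; elim: k => [|k IH] Cf.
  by split=> x Ux; apply: continuous_comp; [exact: Cf|exact: continuous_cos
    |exact: Cf|exact: continuous_sin].
have [Cc Cs] := IH (Ck_le Cf).
split; first apply: (@Ck_comp1 k U f cos (fun y => - sin y)) => //.
  exact: CkN.
exact: (@Ck_comp1 k U f sin cos).
Qed.

Section Smooth.
Variable U : set V.
Hypothesis oU : open U.
Implicit Types f g : V -> R.

Lemma smooth_eq (W : normedModType R) (f g : V -> W) :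
  (forall x, U x -> f x = g x) -> smooth_on U f -> smooth_on U g.
Proof. by move=> fg sf k; exact: Ck_eq fg (sf k). Qed.

Lemma smooth_cst (W : normedModType R) (a : W) : smooth_on U (fun=> a).
Proof. by move=> k; exact: Ck_cst. Qed.

Lemma smoothD f g : smooth_on U f -> smooth_on U g ->
  smooth_on U (fun x => f x + g x).
Proof. by move=> sf sg k; exact: CkD. Qed.

Lemma smoothM f g : smooth_on U f -> smooth_on U g ->
  smooth_on U (fun x => f x * g x).
Proof. by move=> sf sg k; exact: CkM. Qed.

Lemma smoothN f : smooth_on U f -> smooth_on U (fun x => - f x).
Proof. by move=> sf k; exact: CkN. Qed.

Lemma smoothX f n : smooth_on U f -> smooth_on U (fun x => f x ^+ n).
Proof.
move=> sf; elim: n => [|n IH]; first exact: smooth_cst.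
apply: smooth_eq (smoothM sf IH) => x _; by rewrite exprS.
Qed.

Lemma smoothV f : (forall x, U x -> f x != 0) -> smooth_on U f ->
  smooth_on U (fun x => (f x)^-1).
Proof. by move=> f0 sf k; exact: CkV. Qed.

Lemma smooth_sqrt f : (forall x, U x -> 0 < f x) -> smooth_on U f ->
  smooth_on U (fun x => Num.sqrt (f x)).
Proof. by move=> f0 sf k; exact: Ck_sqrt. Qed.

Lemma smooth_cos f : smooth_on U f -> smooth_on U (fun x => cos (f x)).
Proof. by move=> sf k; have [] := Ck_cos_sin oU (sf k). Qed.

Lemma smooth_sin f : smooth_on U f -> smooth_on U (fun x => sin (f x)).
Proof. by move=> sf k; have [] := Ck_cos_sin oU (sf k). Qed.

Lemma smooth_mx n (f : V -> 'rV[R]_n) :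
  (forall j, smooth_on U (fun x => f x 0 j)) -> smooth_on U f.
Proof.
move=> sf k.
have Csum (s : seq 'I_n) :
    Ck_on k U (fun x => \sum_(j <- s) f x 0 j *: delta_mx (0 : 'I_1) j).
  elim: s => [|j s IH].
    by apply: Ck_eq (Ck_cst k (0 : 'rV[R]_n) oU) => // x _; rewrite big_nil.
  apply: Ck_eq (CkD oU (CkZ (delta_mx 0 j) oU (sf j k)) IH) => // x _.
  by rewrite big_cons.
apply: Ck_eq (Csum (index_enum _)) => // x _.
by rewrite [RHS]row_sum_delta.
Qed.

Lemma smooth_differentiable (W : normedModType R) (f : V -> W) x :
  smooth_on U f -> U x -> differentiable f x.
Proof. by move=> sf Ux; have [df _] := sf 1%N; exact: df. Qed.

Lemma smooth_continuous (W : normedModType R) (f : V -> W) x :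
  smooth_on U f -> U x -> {for x, continuous f}.
Proof. by move=> sf Ux; exact: sf 0%N x Ux. Qed.

Lemma smooth_derive (W : normedModType R) (f : V -> W) v :
  smooth_on U f -> smooth_on U ('D_v f).
Proof. by move=> sf k; have [_] := sf k.+1; exact. Qed.

End Smooth.

End SmoothCalculus.

Lemma smooth_coord (R : realType) n (U : set 'rV[R]_n.+1) j : open U ->
  smooth_on U (fun z : 'rV[R]_n.+1 => z 0 j).
Proof.
move=> oU; case=> [|k]; first by move=> x _; exact: coord_continuous.
split=> [x _|v]; first exact: differentiable_coord.
apply: (@Ck_eq _ _ _ _ _ (fun=> v 0 j)) => //; last exact: Ck_cst.
move=> x _.
have /derive_mx : derivable (id : 'rV[R]_n.+1 -> _) x v by exact: derivable_id.
by rewrite derive_id => /matrixP /(_ 0 j); rewrite mxE.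
Qed.


(** * Real inequalities and an identity *)

Section Algebra.
Variable R : realFieldType.

(** The second derivative of the energy function on a tangent vector v of S at z,
in terms of the splitting of R^4 into the two planes rotated by the torus.
Here A and B (A2 and B2) are the squared lengths of the components of z (of v)
in the two planes, P and Q the scalar products of corresponding components,
A + B = 2 L, and the last hypothesis says that v is tangent. For P <> 0 the
term in B2 is dropped and A2 is bounded below by P^2 / A. Since
C > 3/2, the equation of S gives 2 L^2 A < (1 - L)^2 (1 + 2 L), so that A is of
the second order in 1 - L, and what remains is a polynomial inequality in L on
the interval from 0 to 1. *)
Lemma toric_hessian_gt0 (L A B A2 B2 P Q C : R) :
  0 < L -> L < 1 -> 3 / 2 < C -> A + B = 2 * L -> A - B = L ^- 2 - 2 * C ->
  0 <= A2 -> 0 <= B2 -> 0 < A2 + B2 ->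
  P ^+ 2 <= A * A2 -> (1 + L ^+ 3) * P = - ((1 - L ^+ 3) * Q) ->
  3 * (P + Q) ^+ 2 < L * ((1 + L ^+ 3) * A2 + (1 - L ^+ 3) * B2).
Proof.
move=> L0 L1 hC AB1 AB2 A20 B20 AB20 PA PQ.
have L30 : 0 < L ^+ 3 by rewrite exprn_gt0.
have L31 : L ^+ 3 < 1 by rewrite exprn_ilt1 // ltW.
have [P0|P0] := eqVneq P 0.
  have Q0 : Q = 0.
    move: PQ; rewrite P0 mulr0 => /eqP; rewrite eq_sym oppr_eq0 mulf_eq0.
    by case/orP => /eqP // h; move: L31; rewrite -subr_gt0 h ltxx.
  rewrite P0 Q0 addr0 expr0n mulr0 mulr_gt0 //.
  have [A2p|A2p] := ltP 0 A2.
    by rewrite ltr_wpDr ?mulr_ge0 ?mulr_gt0 //; lra.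
  have -> : A2 = 0 by apply/eqP; rewrite eq_le A2p.
  by rewrite mulr0 add0r mulr_gt0; lra.
have P2 : 0 < P ^+ 2 by rewrite exprn_even_gt0.
have A2p : 0 < A2.
  rewrite lt_neqAle A20 andbT; apply/eqP => h; move: (lt_le_trans P2 PA).
  by rewrite -h mulr0 ltxx.
have hA : 2 * L ^+ 2 * A < (1 - L) ^+ 2 * (1 + 2 * L).
  have -> : A = L + (L ^- 2) / 2 - C by lra.
  rewrite (_ : 2 * _ * _ = 2 * L ^+ 3 + 1 - 2 * C * L ^+ 2); last first.
    by field; apply: lt0r_neq0.
  have : 0 < L ^+ 2 * (2 * C - 3) by rewrite mulr_gt0 ?exprn_gt0//; lra.
  by rewrite !exprS expr0; lra.
(* quotient of the difference by (1 - L)^2, which has L = 1 as a further root *)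
have key : 6 * L ^+ 3 * ((1 - L) ^+ 2 * (1 + 2 * L)) <= (1 + L ^+ 3) * (1 - L ^+ 3) ^+ 2.
  rewrite -subr_ge0.
  rewrite (_ : _ - _ = (1 - L) ^+ 3 * (1 + 3 * L + 6 * L ^+ 2 + 3 * L ^+ 3
      - 6 * L ^+ 4 - 3 * L ^+ 5 - L ^+ 6)); last by ring.
  rewrite mulr_ge0 ?exprn_ge0 ?subr_ge0 ?ltW //.
  have L4 : L ^+ 4 <= L ^+ 2 by rewrite ler_wiXn2l // ltW.
  have L5 : L ^+ 5 <= L ^+ 3 by rewrite ler_wiXn2l // ltW.
  have L6 : L ^+ 6 <= L ^+ 1 by rewrite ler_wiXn2l // ltW.
  have := exprn_gt0 2 L0; lra.
have d0 : 0 < 1 - L ^+ 3 by rewrite subr_gt0.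
have e1 : (1 - L ^+ 3) * (P + Q) = - (2 * L ^+ 3 * P).
  by rewrite mulrDr -[_ * Q]opprK -PQ; ring.
have e2 : (1 - L ^+ 3) ^+ 2 * (P + Q) ^+ 2 = 4 * L ^+ 6 * P ^+ 2.
  by rewrite -exprMn e1; ring.
rewrite -(ltr_pM2l (exprn_gt0 2 d0)).
apply: (@lt_le_trans _ _ ((1 - L ^+ 3) ^+ 2 * (L * ((1 + L ^+ 3) * A2)))); last first.
  rewrite ler_pM2l ?exprn_gt0// ler_pM2l // lerDl mulr_ge0 // ltW //.
rewrite mulrCA e2.
apply: (@le_lt_trans _ _ (6 * L ^+ 4 * A2 * (2 * L ^+ 2 * A))).
  rewrite (_ : 6 * _ * _ * _ = 12 * L ^+ 6 * (A * A2)); last by ring.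
  rewrite (_ : 3 * _ = 12 * L ^+ 6 * P ^+ 2); last by ring.
  by rewrite ler_pM2l // mulr_gt0 ?exprn_gt0.
apply: (@lt_le_trans _ _ (6 * L ^+ 4 * A2 * ((1 - L) ^+ 2 * (1 + 2 * L)))).
  by rewrite ltr_pM2l // !mulr_gt0 ?exprn_gt0.
rewrite (_ : 6 * _ * _ * _ = L * A2 * (6 * L ^+ 3 * ((1 - L) ^+ 2 * (1 + 2 * L)))); last by ring.
rewrite (_ : (1 - L ^+ 3) ^+ 2 * (_ * _) = L * A2 * ((1 + L ^+ 3) * (1 - L ^+ 3) ^+ 2)); last by ring.
by rewrite ler_pM2l // mulr_gt0.
Qed.

(** With r = |q|, k minus twice the Kepler energy and J the angular momentum, the
last hypothesis is J^2 <= |q|^2 |p|^2 and the second one is the equation of the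
energy surface. The point is that 4 J^2 > (3 - k)^2 >= 4 (2 - k) for k <= 3,
whereas 4 (2 - k) - 4 (2 r - k r^2) = 4 (1 - r) (2 - k (1 + r)). *)
Lemma radius_lt1 (r k J C : R) : 3 / 2 < C -> J = C - k / 2 -> 0 < r ->
  J ^+ 2 <= 2 * r - k * r ^+ 2 -> (r < 1) = (1 < k).
Proof.
move=> hC eJ r0 hJ.
have lower : k <= 3 -> (3 - k) ^+ 2 < 4 * J ^+ 2.
  move=> k3; rewrite eJ -subr_gt0.
  rewrite (_ : _ - _ = (2 * C - 3) * (2 * C + 3 - 2 * k)); last by field.
  by rewrite mulr_gt0; lra.
have upper : 0 <= (1 - r) * (2 - k * (1 + r)) -> 3 < k.
  move=> h; rewrite ltNge; apply/negP => /lower.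
  have : 0 <= (1 - k) ^+ 2 by exact: sqr_ge0.
  nra.
apply/idP/idP => [r1|k1]; rewrite ltNge; apply/negP => h.
  suff : 3 < k by lra.
  have : 0 <= (1 - k) * (1 + r) by rewrite mulr_ge0; lra.
  by move=> ?; apply: upper; rewrite mulr_ge0; lra.
have k3 : 3 < k.
  have : 0 <= (k - 1) * (1 + r) by rewrite mulr_ge0; lra.
  by move=> ?; apply: upper; rewrite mulr_le0; lra.
have : 0 <= J ^+ 2 by exact: sqr_ge0.
nra.
Qed.

(** The pull-back of the symplectic form by (x, y) |-> (L x^2 / 2, x y / (L |x|^2)),
evaluated on two tangent vectors, which are marked by a prime and by the
suffix d. No relation between L and (x, y) enters: the identity expresses that
the Liouville form pulls back to y dx + <x, y> dL / (2 L). *)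
Lemma scaled_levi_civita_form (x1 x2 y1 y2 L x1' x2' y1' y2' L' x1d x2d y1d y2d Ld : R) :
  L != 0 -> x1 ^+ 2 + x2 ^+ 2 != 0 ->
  let u1' := L' / 2 * (x1 ^+ 2 - x2 ^+ 2) + L * (x1 * x1' - x2 * x2') in
  let u2' := L' * (x1 * x2) + L * (x1' * x2 + x1 * x2') in
  let u1d := Ld / 2 * (x1 ^+ 2 - x2 ^+ 2) + L * (x1 * x1d - x2 * x2d) in
  let u2d := Ld * (x1 * x2) + L * (x1d * x2 + x1 * x2d) in
  let N := x1 ^+ 2 + x2 ^+ 2 in
  let m1 := y1 * x1 - y2 * x2 in
  let m2 := y1 * x2 + y2 * x1 in
  let w1' := (y1' * x1 + y1 * x1' - y2' * x2 - y2 * x2') / (L * N)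
    - m1 * (L' * N + L * (2 * (x1 * x1' + x2 * x2'))) / (L * N) ^+ 2 in
  let w2' := (y1' * x2 + y1 * x2' + y2' * x1 + y2 * x1') / (L * N)
    - m2 * (L' * N + L * (2 * (x1 * x1' + x2 * x2'))) / (L * N) ^+ 2 in
  let w1d := (y1d * x1 + y1 * x1d - y2d * x2 - y2 * x2d) / (L * N)
    - m1 * (Ld * N + L * (2 * (x1 * x1d + x2 * x2d))) / (L * N) ^+ 2 in
  let w2d := (y1d * x2 + y1 * x2d + y2d * x1 + y2 * x1d) / (L * N)
    - m2 * (Ld * N + L * (2 * (x1 * x1d + x2 * x2d))) / (L * N) ^+ 2 in
  w1' * u1d + w2' * u2d - (u1' * w1d + u2' * w2d) =
  y1' * x1d + y2' * x2d - (x1' * y1d + x2' * y2d)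
  + ((x1' * y1 + x1 * y1' + x2' * y2 + x2 * y2') * Ld
     - (x1d * y1 + x1 * y1d + x2d * y2 + x2 * y2d) * L') / (2 * L).
Proof. move=> L0 N0 /=; field; rewrite L0 /=; exact: N0. Qed.

End Algebra.

(** * Directional derivatives and coordinates of R^4 *)

Section DirectionalDerivatives.
Variables (R : realType) (V : normedModType R).
Implicit Types (f g : V -> R) (x v : V).

Lemma dirD f g x v (df dg : R) : is_derive x v f df -> is_derive x v g dg ->
  is_derive x v (fun z => f z + g z) (df + dg).
Proof. by move=> hf hg; exact: is_deriveD. Qed.

Lemma dirN f x v (df : R) : is_derive x v f df ->
  is_derive x v (fun z => - f z) (- df).
Proof. by move=> hf; exact: is_deriveN. Qed.

Lemma dirM f g x v (df dg : R) : is_derive x v f df -> is_derive x v g dg ->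
  is_derive x v (fun z => f z * g z) (df * g x + f x * dg).
Proof.
move=> hf hg; apply: is_derive_eq (is_deriveM hf hg) _.
by rewrite addrC mulrC.
Qed.

Lemma dirX f x v n (df : R) : is_derive x v f df ->
  is_derive x v (fun z => f z ^+ n) (n%:R * f x ^+ n.-1 * df).
Proof.
move=> hf; have -> : (fun z => f z ^+ n) = f ^+ n by rewrite exprfctE.
exact: is_deriveX.
Qed.

Lemma dirV f x v (df : R) : f x != 0 -> is_derive x v f df ->
  is_derive x v (fun z => (f z)^-1) (- (df / f x ^+ 2)).
Proof.
move=> fx [f1 f2]; split; first exact: derivableV.
by rewrite deriveV // f2 [LHS]mulNr mulrC.
Qed.

Lemma dirC (a : R) x v : is_derive x v (fun=> a) (0 : R).
Proof. exact: is_derive_cst. Qed.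

End DirectionalDerivatives.

Lemma dir_cos (R : realType) (f : R -> R) (x df : R) : is_derive x 1 f df ->
  is_derive x 1 (fun z => cos (f z)) (- sin (f x) * df).
Proof. by move=> hf; apply: (is_derive1_comp (f := cos)). Qed.

Lemma dir_sin (R : realType) (f : R -> R) (x df : R) : is_derive x 1 f df ->
  is_derive x 1 (fun z => sin (f z)) (cos (f x) * df).
Proof. by move=> hf; apply: (is_derive1_comp (f := sin)). Qed.

Section Coordinates.
Variable R : realType.
Local Notation R4 := 'rV[R]_(2 + 2).

Definition row2 (a b : R) : 'rV[R]_2 := \row_j (if j == 0 then a else b).
Definition coord4 (a b c d : R) : R4 := row_mx (row2 a b) (row2 c d).

Definition x1 (z : R4) : R := pos z 0 0.
Definition x2 (z : R4) : R := pos z 0 1.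
Definition y1 (z : R4) : R := mom z 0 0.
Definition y2 (z : R4) : R := mom z 0 1.

Lemma sum2 (F : 'I_2 -> R) : \sum_i F i = F 0 + F 1.
Proof.
rewrite !big_ord_recl big_ord0 addr0; congr (_ + F _); exact: val_inj.
Qed.

Lemma row2P (u w : 'rV[R]_2) : u 0 0 = w 0 0 -> u 0 1 = w 0 1 -> u = w.
Proof.
move=> h0 h1; apply/rowP => j; case: j => [[|[|//]]] lt_j.
  by rewrite (_ : Ordinal _ = 0) //; exact: val_inj.
by rewrite (_ : Ordinal _ = 1) //; exact: val_inj.
Qed.

Lemma row2_0 a b : row2 a b 0 0 = a. Proof. by rewrite mxE. Qed.
Lemma row2_1 a b : row2 a b 0 1 = b. Proof. by rewrite mxE. Qed.

Lemma pos_coord4 a b c d : pos (coord4 a b c d) = row2 a b.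
Proof. exact: row_mxKl. Qed.
Lemma mom_coord4 a b c d : mom (coord4 a b c d) = row2 c d.
Proof. exact: row_mxKr. Qed.
Lemma x1_coord4 a b c d : x1 (coord4 a b c d) = a.
Proof. by rewrite /x1 pos_coord4 row2_0. Qed.
Lemma x2_coord4 a b c d : x2 (coord4 a b c d) = b.
Proof. by rewrite /x2 pos_coord4 row2_1. Qed.
Lemma y1_coord4 a b c d : y1 (coord4 a b c d) = c.
Proof. by rewrite /y1 mom_coord4 row2_0. Qed.
Lemma y2_coord4 a b c d : y2 (coord4 a b c d) = d.
Proof. by rewrite /y2 mom_coord4 row2_1. Qed.

Definition coord4E := (x1_coord4, x2_coord4, y1_coord4, y2_coord4).

Lemma coord4P z w : x1 z = x1 w -> x2 z = x2 w -> y1 z = y1 w -> y2 z = y2 w ->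
  z = w.
Proof.
move=> h1 h2 h3 h4; rewrite -(hsubmxK z) -(hsubmxK w); congr row_mx.
  exact: row2P.
exact: row2P.
Qed.

Lemma x1D z w : x1 (z + w) = x1 z + x1 w. Proof. by rewrite /x1 !mxE. Qed.
Lemma x2D z w : x2 (z + w) = x2 z + x2 w. Proof. by rewrite /x2 !mxE. Qed.
Lemma y1D z w : y1 (z + w) = y1 z + y1 w. Proof. by rewrite /y1 !mxE. Qed.
Lemma y2D z w : y2 (z + w) = y2 z + y2 w. Proof. by rewrite /y2 !mxE. Qed.
Lemma x1Z a z : x1 (a *: z) = a * x1 z. Proof. by rewrite /x1 !mxE. Qed.
Lemma x2Z a z : x2 (a *: z) = a * x2 z. Proof. by rewrite /x2 !mxE. Qed.
Lemma y1Z a z : y1 (a *: z) = a * y1 z. Proof. by rewrite /y1 !mxE. Qed.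
Lemma y2Z a z : y2 (a *: z) = a * y2 z. Proof. by rewrite /y2 !mxE. Qed.

Definition coordDZ := (x1D, x2D, y1D, y2D, x1Z, x2Z, y1Z, y2Z).

Lemma x1E z : x1 z = z 0 (lshift 2 0). Proof. by rewrite /x1 mxE. Qed.
Lemma x2E z : x2 z = z 0 (lshift 2 1). Proof. by rewrite /x2 mxE. Qed.
Lemma y1E z : y1 z = z 0 (rshift 2 0). Proof. by rewrite /y1 mxE. Qed.
Lemma y2E z : y2 z = z 0 (rshift 2 1). Proof. by rewrite /y2 mxE. Qed.

Lemma ord4P (P : 'I_(2 + 2) -> Prop) :
  P (lshift 2 0) -> P (lshift 2 1) -> P (rshift 2 0) -> P (rshift 2 1) ->
  forall j, P j.
Proof.
move=> h1 h2 h3 h4 j.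
case: (fintype.splitP j) => k jk.
  have -> : j = lshift 2 k by exact: val_inj.
  case: k {jk} => [[|[|//]]] lt_k.
    by rewrite (_ : Ordinal _ = 0) //; exact: val_inj.
  by rewrite (_ : Ordinal _ = 1) //; exact: val_inj.
have -> : j = rshift 2 k by exact: val_inj.
case: k {jk} => [[|[|//]]] lt_k.
  by rewrite (_ : Ordinal _ = 0) //; exact: val_inj.
by rewrite (_ : Ordinal _ = 1) //; exact: val_inj.
Qed.

Lemma omegaE (u v : R4) : omega u v =
  y1 u * x1 v - x1 u * y1 v + (y2 u * x2 v - x2 u * y2 v).
Proof. by rewrite /omega sum2. Qed.

Section SmoothCoordinates.
Variable U : set R4.
Hypothesis oU : open U.

Lemma smooth_x1 : smooth_on U x1.
Proof.
apply: (@smooth_eq _ _ U oU _ (fun z : R4 => z 0 (lshift 2 0))).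
  by move=> z _; rewrite x1E.
exact: (@smooth_coord R 3).
Qed.

Lemma smooth_x2 : smooth_on U x2.
Proof.
apply: (@smooth_eq _ _ U oU _ (fun z : R4 => z 0 (lshift 2 1))).
  by move=> z _; rewrite x2E.
exact: (@smooth_coord R 3).
Qed.

Lemma smooth_y1 : smooth_on U y1.
Proof.
apply: (@smooth_eq _ _ U oU _ (fun z : R4 => z 0 (rshift 2 0))).
  by move=> z _; rewrite y1E.
exact: (@smooth_coord R 3).
Qed.

Lemma smooth_y2 : smooth_on U y2.
Proof.
apply: (@smooth_eq _ _ U oU _ (fun z : R4 => z 0 (rshift 2 1))).
  by move=> z _; rewrite y2E.
exact: (@smooth_coord R 3).
Qed.

Lemma smooth_coord4 (a b c d : R4 -> R) :
  smooth_on U a -> smooth_on U b -> smooth_on U c -> smooth_on U d ->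
  smooth_on U (fun z => coord4 (a z) (b z) (c z) (d z)).
Proof.
move=> sa sb sc sd; apply: smooth_mx => // j.
elim/ord4P : j; [apply: smooth_eq sa|apply: smooth_eq sb
  |apply: smooth_eq sc|apply: smooth_eq sd] => // z _.
- by rewrite -x1E x1_coord4.
- by rewrite -x2E x2_coord4.
- by rewrite -y1E y1_coord4.
- by rewrite -y2E y2_coord4.
Qed.

End SmoothCoordinates.

Section CurveCoordinates.
Variables (V : normedModType R) (gamma : V -> R4) (t v : V).
Hypothesis dg : derivable gamma t v.

Let dcoord j : is_derive t v (fun s => gamma s 0 j) ('D_v gamma t 0 j).
Proof.
split; first by move: dg => /derivable_mxP.
by rewrite (derive_mx dg) mxE.
Qed.

Lemma dir_x1 : is_derive t v (fun s => x1 (gamma s)) (x1 ('D_v gamma t)).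
Proof. by under eq_fun do rewrite x1E; rewrite x1E. Qed.
Lemma dir_x2 : is_derive t v (fun s => x2 (gamma s)) (x2 ('D_v gamma t)).
Proof. by under eq_fun do rewrite x2E; rewrite x2E. Qed.
Lemma dir_y1 : is_derive t v (fun s => y1 (gamma s)) (y1 ('D_v gamma t)).
Proof. by under eq_fun do rewrite y1E; rewrite y1E. Qed.
Lemma dir_y2 : is_derive t v (fun s => y2 (gamma s)) (y2 ('D_v gamma t)).
Proof. by under eq_fun do rewrite y2E; rewrite y2E. Qed.

End CurveCoordinates.

Lemma derive_coord4 (V : normedModType R) (a b c d : V -> R) (a' b' c' d' : R) t v :
  is_derive t v a a' -> is_derive t v b b' -> is_derive t v c c' ->
  is_derive t v d d' ->
  'D_v (fun s => coord4 (a s) (b s) (c s) (d s)) t = coord4 a' b' c' d'.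
Proof.
move=> ha hb hc hd.
set g := fun s => _.
have E (j : 'I_(2 + 2)) : is_derive t v (fun s => g s 0 j) (coord4 a' b' c' d' 0 j).
  elim/ord4P : j; rewrite -?x1E -?x2E -?y1E -?y2E ?coord4E.
  - by under eq_fun do rewrite -x1E x1_coord4.
  - by under eq_fun do rewrite -x2E x2_coord4.
  - by under eq_fun do rewrite -y1E y1_coord4.
  - by under eq_fun do rewrite -y2E y2_coord4.
have dg : derivable g t v by apply/derivable_mxP => i j; rewrite ord1; case: (E j).
by apply/rowP => j; rewrite (derive_mx dg) mxE; case: (E j).
Qed.

End Coordinates.

(** * The second fundamental form of a level set *)

Section SecondFundamentalForm.
Variables (R : realType) (n : nat).
Notation E := 'rV[R]_n.+1.
Implicit Types (F : E -> R) (U : set E) (x u v : E).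

Lemma dot_grad F x v : differentiable F x -> dot (grad F x) v = 'D_v F x.
Proof.
move=> dF; rewrite deriveE // [in RHS](row_sum_delta v) linear_sum /dot.
by apply: eq_bigr => i _; rewrite linearZ mxE deriveE // mulrC.
Qed.

Lemma dot_ge0 u : 0 <= dot u u.
Proof. by apply: sumr_ge0 => i _; rewrite -expr2 sqr_ge0. Qed.

Lemma dot_gt0 u : u != 0 -> 0 < dot u u.
Proof.
move=> u0; rewrite lt_neqAle dot_ge0 andbT eq_sym; apply: contra u0 => /eqP.
move/psumr_eq0P => h; apply/eqP/rowP => i; rewrite mxE.
by have /eqP := h (fun i _ => sqr_ge0 _) i isT; rewrite -expr2 sqrf_eq0 => /eqP.
Qed.

Lemma smooth_sum U (f : 'I_n.+1 -> E -> R) : open U ->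
  (forall i, smooth_on U (f i)) -> smooth_on U (fun z => \sum_i f i z).
Proof.
move=> oU sf.
elim: (index_enum _) => [|i s IH].
  by apply: (smooth_eq oU) (smooth_cst oU (0 : R)) => z _; rewrite big_nil.
by apply: (smooth_eq oU) (smoothD oU (sf i) IH) => z _; rewrite big_cons.
Qed.

Lemma smooth_grad U F i : open U -> smooth_on U F ->
  smooth_on U (fun z => grad F z 0 i).
Proof.
move=> oU sF; apply: (smooth_eq oU) (smooth_derive (delta_mx 0 i) sF) => z _.
by rewrite mxE.
Qed.

Lemma smooth_enorm_grad U F : open U -> smooth_on U F ->
  (forall z, U z -> grad F z != 0) ->
  smooth_on U (fun z => (enorm (grad F z))^-1).
Proof.
move=> oU sF g0; apply: smoothV => //.
  by move=> z Uz; rewrite sqrtr_eq0 -ltNge dot_gt0 ?g0.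
apply: smooth_sqrt => // [z Uz|]; first by rewrite dot_gt0 ?g0.
by apply: smooth_sum => // i; apply: smoothM => //; exact: smooth_grad.
Qed.

(** In D_v of (1 / |grad F|) <grad F, v> the term in which the scalar factor is
differentiated drops out on tangent vectors, because <grad F, v> vanishes. *)
Lemma second_fundamental_form_tangent U F x v :
  open U -> U x -> smooth_on U F -> (forall z, U z -> grad F z != 0) ->
  'D_v F x = 0 ->
  second_fundamental_form F x v v = (enorm (grad F x))^-1 * 'D_v ('D_v F) x.
Proof.
move=> oU Ux sF g0 dF0.
pose h z := (enorm (grad F z))^-1.
have sh : smooth_on U h by exact: smooth_enorm_grad.
have sN i : smooth_on U (fun z => unit_normal F z 0 i).
  apply: (smooth_eq oU) (smoothN oU (smoothM oU sh (smooth_grad i oU sF))) => z _.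
  by rewrite /unit_normal !mxE.
have dN : derivable (unit_normal F) x v.
  apply/derivable_mxP => i j; rewrite ord1; apply: diff_derivable.
  exact: smooth_differentiable (sN j) Ux.
rewrite /second_fundamental_form.
have -> : dot ('D_v (unit_normal F) x) v =
    'D_v (fun z => - (h z * 'D_v F z)) x.
  transitivity ('D_v (\sum_(i < n.+1) (fun z => unit_normal F z 0 i * v 0 i)) x).
    rewrite derive_sum; last first.
      move=> i; apply: derivableM; last exact: derivable_cst.
      by move/derivable_mxP : dN; apply.
    rewrite /dot (derive_mx dN); apply: eq_bigr => i _; rewrite mxE.
    rewrite (deriveM _ (derivable_cst _ _ _)); last by move/derivable_mxP : dN; apply.
    by rewrite derive_cst scaler0 add0r mulrC.
  apply: near_eq_derive.
  have := open_nbhs_nbhs (conj oU Ux); apply: filterS => z Uz.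
  rewrite fct_sumE -dot_grad; last exact: smooth_differentiable sF Uz.
  rewrite /dot mulr_sumr -sumrN; apply: eq_bigr => i _.
  by rewrite /unit_normal !mxE mulrA mulNr.
have dh : derivable h x v by apply/diff_derivable/smooth_differentiable.
have ddF : derivable ('D_v F) x v.
  by apply/diff_derivable/smooth_differentiable; first exact: smooth_derive sF.
have [_ ->] := dirN (dirM (derivableP dh) (derivableP ddF)).
by rewrite dF0 mulr0 add0r opprK.
Qed.

End SecondFundamentalForm.

(** * The regularized energy surface *)

Section EnergyFunction.
Variable R : realType.
Local Notation R4 := 'rV[R]_(2 + 2).
Implicit Types (z v w : R4) (C : R).

(** The action variable L of the Kepler problem, for which the Kepler energy is
- 1 / (2 L^2). *)
Definition action z := (x1 z ^+ 2 + x2 z ^+ 2 + (y1 z ^+ 2 + y2 z ^+ 2)) / 4.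
Definition angmom z := (x1 z * y2 z - x2 z * y1 z) / 2.
(** L^2 times the difference of the energies - 1 / (2 L^2) - J and - C; the factor
makes it a polynomial. *)
Definition energy_fun C z := (C - angmom z) * action z ^+ 2 - 2^-1.

Definition regularized_surface C : set R4 :=
  [set z | action z < 1 /\ energy_fun C z = 0].
Definition regularized_domain C : set R4 :=
  [set z | action z < 1 /\ energy_fun C z < 0].

(** The derivative of the quadratic form at z in the direction v, which is twice
the polar form. *)
Definition action_polar z v :=
  (x1 z * x1 v + x2 z * x2 v + (y1 z * y1 v + y2 z * y2 v)) / 2.
Definition angmom_polar z v :=
  (x1 z * y2 v + x1 v * y2 z - (x2 z * y1 v + x2 v * y1 z)) / 2.

(** [denergy C z v] and [ddenergy C z v] are the first and second derivatives
of the energy function at z in the direction v. *)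
Definition denergy C z v :=
  2 * (C - angmom z) * action z * action_polar z v
  - angmom_polar z v * action z ^+ 2.
Definition ddenergy C z v :=
  2 * (C - angmom z) * (action_polar z v ^+ 2 + 2 * action z * action v)
  - 4 * angmom_polar z v * action z * action_polar z v
  - 2 * angmom v * action z ^+ 2.

Lemma action_ge0 z : 0 <= action z.
Proof. by rewrite divr_ge0 // !addr_ge0 ?sqr_ge0. Qed.

Lemma angmom_le z : angmom z <= action z.
Proof.
rewrite -subr_ge0 (_ : _ - _ = ((x1 z - y2 z) ^+ 2 + (x2 z + y1 z) ^+ 2) / 4).
  by rewrite divr_ge0 // addr_ge0 ?sqr_ge0.
by rewrite /action /angmom; field.
Qed.

Lemma angmom_ge z : - angmom z <= action z.
Proof.
rewrite -subr_ge0 (_ : _ - _ = ((x1 z + y2 z) ^+ 2 + (x2 z - y1 z) ^+ 2) / 4).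
  by rewrite divr_ge0 // addr_ge0 ?sqr_ge0.
by rewrite /action /angmom; field.
Qed.

Lemma action_gt0 z : z != 0 -> 0 < action z.
Proof.
move=> z0; rewrite lt_neqAle action_ge0 andbT eq_sym; apply: contra z0.
rewrite mulf_eq0 invr_eq0 pnatr_eq0 orbF.
rewrite !paddr_eq0 ?addr_ge0 ?sqr_ge0 // !sqrf_eq0.
case/andP => /andP[/eqP h1 /eqP h2] /andP[/eqP h3 /eqP h4].
by apply/eqP/coord4P; rewrite ?h1 ?h2 ?h3 ?h4 /x1 /x2 /y1 /y2 !mxE.
Qed.

Lemma actionZ a z : action (a *: z) = a ^+ 2 * action z.
Proof. by rewrite /action !coordDZ; field. Qed.

Lemma angmomZ a z : angmom (a *: z) = a ^+ 2 * angmom z.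
Proof. by rewrite /angmom !coordDZ; field. Qed.

Lemma surface_action_gt0 C z : regularized_surface C z -> 0 < action z.
Proof.
move=> [_ F0]; rewrite lt_neqAle action_ge0 andbT; apply/eqP => h.
by move: F0; rewrite /energy_fun -h expr0n mulr0 sub0r; lra.
Qed.

Lemma surfaceE C z : regularized_surface C z ->
  C - angmom z = (action z ^- 2) / 2.
Proof.
move=> Sz; have L0 := surface_action_gt0 Sz; move: Sz => [_ /eqP].
rewrite subr_eq0 => /eqP h.
have L20 : action z ^+ 2 != 0 by rewrite expf_neq0 // gt_eqF.
by apply: (mulIf L20); rewrite h; field; rewrite gt_eqF.
Qed.

Lemma surfaceP C z : 0 < action z -> action z < 1 ->
  angmom z = C - (action z ^- 2) / 2 -> regularized_surface C z.
Proof.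
move=> L0 L1 h; split=> //; rewrite /energy_fun h; field.
by rewrite gt_eqF.
Qed.

Lemma dir_action (V : normedModType R) (gamma : V -> R4) (t v : V) :
  derivable gamma t v ->
  is_derive t v (fun s => action (gamma s))
    (action_polar (gamma t) ('D_v gamma t)).
Proof.
move=> dg.
have ha := dirX 2 (dir_x1 dg); have hb := dirX 2 (dir_x2 dg).
have hc := dirX 2 (dir_y1 dg); have hd := dirX 2 (dir_y2 dg).
apply: is_derive_eq (dirM (dirD (dirD ha hb) (dirD hc hd)) (dirC _ _ _)) _.
by rewrite /action_polar /=; field.
Qed.

Lemma dir_angmom (V : normedModType R) (gamma : V -> R4) (t v : V) :
  derivable gamma t v ->
  is_derive t v (fun s => angmom (gamma s))
    (angmom_polar (gamma t) ('D_v gamma t)).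
Proof.
move=> dg.
have ha := dirM (dir_x1 dg) (dir_y2 dg); have hb := dirM (dir_x2 dg) (dir_y1 dg).
apply: is_derive_eq (dirM (dirD ha (dirN hb)) (dirC _ _ _)) _.
by rewrite /angmom_polar /=; field.
Qed.

Lemma dir_energy (V : normedModType R) (gamma : V -> R4) C (t v : V) :
  derivable gamma t v ->
  is_derive t v (fun s => energy_fun C (gamma s))
    (denergy C (gamma t) ('D_v gamma t)).
Proof.
move=> dg.
have hA := dir_action dg; have hJ := dir_angmom dg.
apply: is_derive_eq (dirD (dirM (dirD (dirC C _ _) (dirN hJ)) (dirX 2 hA)) (dirC _ _ _)) _.
by rewrite /denergy /=; ring.
Qed.

Lemma derive_energy C v : 'D_v (energy_fun C) = fun z => denergy C z v.
Proof.
apply/funext => z.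
have did : derivable (id : R4 -> R4) z v by exact: derivable_id.
have [_] := dir_energy C did.
by rewrite derive_id.
Qed.

Lemma derive2_energy C z v :
  'D_v ('D_v (energy_fun C)) z = ddenergy C z v.
Proof.
rewrite derive_energy.
have did : derivable (id : R4 -> R4) z v by exact: derivable_id.
have hA := dir_action did; have hJ := dir_angmom did.
have hAp : is_derive z v (fun w => action_polar w v) (2 * action v).
  have ha := dirM (dir_x1 did) (dirC (x1 v) z v).
  have hb := dirM (dir_x2 did) (dirC (x2 v) z v).
  have hc := dirM (dir_y1 did) (dirC (y1 v) z v).
  have hd := dirM (dir_y2 did) (dirC (y2 v) z v).
  apply: is_derive_eq (dirM (dirD (dirD ha hb) (dirD hc hd)) (dirC _ _ _)) _.
  by rewrite derive_id /action /=; field.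
have hJp : is_derive z v (fun w => angmom_polar w v) (2 * angmom v).
  have ha := dirM (dir_x1 did) (dirC (y2 v) z v).
  have hb := dirM (dirC (x1 v) z v) (dir_y2 did).
  have hc := dirM (dir_x2 did) (dirC (y1 v) z v).
  have hd := dirM (dirC (x2 v) z v) (dir_y1 did).
  apply: is_derive_eq (dirM (dirD (dirD ha hb) (dirN (dirD hc hd))) (dirC _ _ _)) _.
  by rewrite derive_id /angmom /=; field.
have [_ ->] := dirD (dirM (dirM (dirM (dirC 2 z v) (dirD (dirC C z v) (dirN hJ)))
   hA) hAp) (dirN (dirM hJp (dirX 2 hA))).
by rewrite derive_id /ddenergy /=; ring.
Qed.

Lemma smooth_action (U : set R4) : open U -> smooth_on U action.
Proof.
move=> oU.
have sa := smooth_x1 oU; have sb := smooth_x2 oU.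
have sc := smooth_y1 oU; have sd := smooth_y2 oU.
apply: smoothM => //; last exact: smooth_cst.
by do ![apply: smoothD => //]; apply: smoothX.
Qed.

Lemma smooth_angmom (U : set R4) : open U -> smooth_on U angmom.
Proof.
move=> oU.
have sa := smooth_x1 oU; have sb := smooth_x2 oU.
have sc := smooth_y1 oU; have sd := smooth_y2 oU.
apply: smoothM => //; last exact: smooth_cst.
by apply: smoothD => //; [exact: smoothM|apply: smoothN => //; exact: smoothM].
Qed.

Lemma smooth_energy C (U : set R4) : open U -> smooth_on U (energy_fun C).
Proof.
move=> oU; apply: smoothD => //; last exact: smooth_cst.
apply: smoothM => //; last exact/smoothX/smooth_action.
apply: smoothD => //; first exact: smooth_cst.
exact/smoothN/smooth_angmom.
Qed.

Lemma action_continuous : continuous action.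
Proof. by move=> z; apply: smooth_continuous (smooth_action openT) _. Qed.

Lemma energy_continuous C : continuous (energy_fun C).
Proof.
move=> z; apply: smooth_continuous (smooth_energy C openT) _ => //.
Qed.

(** A = L - J and B = L + J are sums of two squares of linear forms, namely the
squared lengths of the components of z in the two planes rotated by the
torus. *)
Lemma ddenergy_gt0 C z v : 3 / 2 < C -> regularized_surface C z -> v != 0 ->
  denergy C z v = 0 -> 0 < ddenergy C z v.
Proof.
move=> hC Sz v0 dF0.
have L0 := surface_action_gt0 Sz; have L1 := Sz.1.
have hJ := surfaceE Sz.
have Lv := action_gt0 v0.
have eq1 : action_polar z v = action z ^+ 3 * angmom_polar z v.
  apply: (mulIf (lt0r_neq0 (exprn_gt0 2 L0))).
  move: dF0; rewrite /denergy hJ => /eqP; rewrite subr_eq0 => /eqP h.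
  rewrite /= -[RHS]mulrA -h; field.
  by rewrite gt_eqF.
have key := @toric_hessian_gt0 R (action z) (action z - angmom z)
  (action z + angmom z) (action v - angmom v) (action v + angmom v)
  ((action_polar z v - angmom_polar z v) / 2)
  ((action_polar z v + angmom_polar z v) / 2) C L0 L1 hC.
have {}key : 3 * action_polar z v ^+ 2 <
    action z * (2 * action v - 2 * action z ^+ 3 * angmom v).
  rewrite [ltLHS](_ : _ = 3 * ((action_polar z v - angmom_polar z v) / 2 +
    (action_polar z v + angmom_polar z v) / 2) ^+ 2); last by field.
  rewrite [ltRHS](_ : _ = action z * ((1 + action z ^+ 3) * (action v - angmom v) +
    (1 - action z ^+ 3) * (action v + angmom v))); last by ring.
  apply: key.
  - ring.
  - by rewrite (_ : action z ^- 2 = 2 * (C - angmom z)); [ring|rewrite hJ; field; rewrite gt_eqF].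
  - by rewrite subr_ge0 angmom_le.
  - by rewrite -[angmom v]opprK subr_ge0 angmom_ge.
  - by rewrite addrACA addNr addr0 addr_gt0.
  - rewrite -subr_ge0 (_ : _ - _ = (((x1 z - y2 z) * (x2 v + y1 v)
      - (x2 z + y1 z) * (x1 v - y2 v)) / 4) ^+ 2) ?sqr_ge0 //.
    by rewrite /action /angmom /action_polar /angmom_polar; field.
  - by rewrite eq1; field.
have L2 := exprn_gt0 2 L0.
rewrite -(pmulr_rgt0 _ L2) (_ : _ * _ = action z * (2 * action v -
  2 * action z ^+ 3 * angmom v) - 3 * action_polar z v ^+ 2) ?subr_gt0 //.
rewrite /ddenergy hJ eq1; field.
by rewrite gt_eqF.
Qed.

End EnergyFunction.

(** * Convexity *)

Section ConvexSurface.
Variables (R : realType) (C : R).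
Local Notation R4 := 'rV[R]_(2 + 2).
Implicit Types (z v w : R4).
Local Notation F := (energy_fun C).
Local Notation S := (regularized_surface C).
Local Notation K := (regularized_domain C).

Lemma action_line z v s :
  action (z + s *: v) = action z + s * action_polar z v + s ^+ 2 * action v.
Proof. by rewrite /action /action_polar !coordDZ; field. Qed.

Lemma angmom_line z v s :
  angmom (z + s *: v) = angmom z + s * angmom_polar z v + s ^+ 2 * angmom v.
Proof. by rewrite /angmom /angmom_polar !coordDZ; field. Qed.

Lemma energy_line z v : exists r : {poly R}, forall s,
  F (z + s *: v) = F z + s * (denergy C z v + s * (ddenergy C z v / 2 + s * r.[s])).
Proof.
pose k := C - angmom z; pose k1 := - angmom_polar z v; pose k2 := - angmom v.
pose l := action z; pose l1 := action_polar z v; pose l2 := action v.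
pose a0 := k * 2 * l1 * l2 + k1 * (l1 ^+ 2 + 2 * l * l2) + k2 * 2 * l * l1.
pose a1 := k * l2 ^+ 2 + k1 * 2 * l1 * l2 + k2 * (l1 ^+ 2 + 2 * l * l2).
pose a2 := k1 * l2 ^+ 2 + k2 * 2 * l1 * l2.
exists (a0%:P + a1 *: 'X + a2 *: 'X^2 + (k2 * l2 ^+ 2) *: 'X^3) => s.
rewrite !(hornerD, hornerZ, hornerXn, hornerX, hornerC).
rewrite /energy_fun action_line angmom_line /denergy /ddenergy.
by rewrite /a0 /a1 /a2 /k /k1 /k2 /l /l1 /l2; field.
Qed.

Lemma poly_le0_at0 (p : {poly R}) (e : R) : 0 < e ->
  (forall s : R, 0 < s -> s < e -> p.[s] <= 0) -> p.[0] <= 0.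
Proof.
move=> e0 hp; rewrite leNgt; apply/negP => p0.
have := @continuous_horner R p 0 => /cvgr_gt /(_ _ p0) h.
have : \forall s \near 0^'+, [/\ 0 < p.[s], 0 < s & s < e].
  near=> s; split.
  - by near: s; apply: cvg_within; exact: h.
  - by near: s; exact: nbhs_right_gt.
  - by near: s; exact: nbhs_right_lt.
by move=> /filter_ex [s [h1 h2 h3]]; move: (hp s h2 h3); rewrite leNgt h1.
Unshelve. all: by end_near. Qed.

(** The tests for an interior maximum, obtained from the Taylor polynomial without
any differentiation. *)
Lemma energy_max z v (e : R) : 0 < e ->
  (forall s : R, `|s| < e -> F (z + s *: v) <= F z) ->
  denergy C z v = 0 /\ ddenergy C z v <= 0.
Proof.
move=> e0 hF; have [r hr] := energy_line z v.
pose p1 : {poly R} := (denergy C z v)%:P + 'X * ((ddenergy C z v / 2)%:P + 'X * r).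
have p1E (s : R) : F (z + s *: v) - F z = s * p1.[s] by rewrite hr !hornerE; ring.
have hp (s : R) : `|s| < e -> s * p1.[s] <= 0.
  by move=> se; rewrite -p1E subr_le0 hF.
have le1 : denergy C z v <= 0.
  have <- : p1.[0] = denergy C z v by rewrite !hornerE; ring.
  apply: (poly_le0_at0 e0) => s s0 se.
  by have := hp s; rewrite gtr0_norm // => /(_ se); rewrite pmulr_rle0.
have ge1 : 0 <= denergy C z v.
  rewrite -oppr_le0.
  have <- : (- (p1 \Po (- 'X))).[0] = - denergy C z v by rewrite !(horner_comp,hornerE); ring.
  apply: (poly_le0_at0 e0) => s s0 se.
  have := hp (- s); rewrite normrN gtr0_norm // => /(_ se).
  by rewrite mulNr -mulrN pmulr_rle0 // hornerN horner_comp hornerN hornerX.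
have d0 : denergy C z v = 0 by apply/eqP; rewrite eq_le le1.
split=> //.
pose p2 : {poly R} := (ddenergy C z v / 2)%:P + 'X * r.
suff : p2.[0] <= 0 by rewrite !hornerE; lra.
apply: (poly_le0_at0 e0) => s s0 se.
have := hp s; rewrite gtr0_norm // => /(_ se).
by rewrite [p1.[s]](_ : _ = s * p2.[s]) ?pmulr_rle0 // !hornerE d0; ring.
Qed.

Lemma action0 : action (0 : R4) = 0.
Proof. by rewrite -(scale0r (0 : R4)) actionZ expr0n mul0r. Qed.

(** The difference of the values at z and t z is L^2 (1 - t^2) times
C (1 + t^2) - J (1 + t^2 + t^4); as J <= L < 1 < 3/2 < C, the second factor is
positive for t < 1. *)
Lemma energy_star z (t : R) : 3 / 2 < C -> action z < 1 -> F z <= 0 -> 0 <= t -> t < 1 ->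
  F (t *: z) < 0.
Proof.
move=> hC L1 F0 t0 t1; rewrite /energy_fun actionZ angmomZ.
have [L0|L0] := eqVneq (action z) 0; first by rewrite L0 mulr0 expr0n mulr0; lra.
have Lp : 0 < action z by rewrite lt_neqAle eq_sym L0 action_ge0.
have J1 := angmom_le z.
apply: lt_le_trans F0; rewrite /energy_fun -subr_gt0.
set l := action z in L0 L1 Lp J1 *; set j := angmom z in J1 *.
rewrite (_ : _ - _ = l ^+ 2 * (1 - t ^+ 2) * (C * (1 + t ^+ 2) - j * (1 + t ^+ 2 + t ^+ 4))); last by ring.
have t2 : t ^+ 2 < 1 by rewrite exprn_ilt1.
have t20 : 0 <= t ^+ 2 by exact: sqr_ge0.
apply: mulr_gt0; first by rewrite mulr_gt0 ?exprn_gt0 ?subr_gt0.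
rewrite (_ : t ^+ 4 = t ^+ 2 * t ^+ 2); last by ring.
move: (t ^+ 2) t2 t20 => u u1 u0.
have uu : 0 <= u * u by rewrite mulr_ge0.
have q0 : 0 < 1 + u + u * u by lra.
have Cu : 0 < (C - 3 / 2) * (1 + u) by rewrite mulr_gt0; lra.
have u2 : 0 <= u * (1 - u) by rewrite mulr_ge0; lra.
have : j * (1 + u + u * u) < 1 + u + u * u by rewrite gtr_pMl //; lra.
lra.
Qed.

Lemma energy_at_action1 z : 3 / 2 < C -> action z <= 1 -> F z <= 0 -> action z < 1.
Proof.
move=> hC L1 F0; rewrite lt_neqAle L1 andbT; apply/eqP => L.
have := angmom_le z; move: F0; rewrite /energy_fun L expr1n mulr1; lra.
Qed.

(** Among the pairs (lam, s) for which lam (z1 + s (z2 - z1)) lies outside K, one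
with minimal lam is a point where the shrunken segment touches S from
inside. *)
Lemma domain_convex z1 z2 (t : R) : 3 / 2 < C -> K z1 -> K z2 -> 0 <= t -> t <= 1 ->
  K (z1 + t *: (z2 - z1)).
Proof.
move=> hC [L1 F1] [L2 F2] t0 t1.
pose zt (s : R) := z1 + s *: (z2 - z1).
have Llt (s : R) : 0 <= s -> s <= 1 -> action (zt s) < 1.
  move=> s0 s1.
  have -> : action (zt s) = (1 - s) * action z1 + s * action z2
      - s * (1 - s) * action (z2 - z1).
    by rewrite /zt /action !coordDZ -scaleN1r !coordDZ; field.
  have d0 : 0 <= s * (1 - s) * action (z2 - z1).
    by rewrite mulr_ge0 ?action_ge0 // mulr_ge0 // subr_ge0.
  have p1 : 0 <= (1 - s) * (1 - action z1) by rewrite mulr_ge0; lra.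
  have p2 : 0 <= s * (1 - action z2) by rewrite mulr_ge0; lra.
  have [sh|sh] := lerP s (1 / 2).
    have : 0 <= (1 / 2 - s) * (1 - action z1) by rewrite mulr_ge0; lra.
    lra.
  have : 0 <= (s - 1 / 2) * (1 - action z2) by rewrite mulr_ge0; lra.
  lra.
split; first exact: Llt.
rewrite ltNge; apply/negP => Ft.
have cG : continuous (fun p : R * R => F (p.1 *: zt p.2)).
  move=> p.
  apply: (@continuous_comp _ _ _ (fun p : R * R => p.1 *: zt p.2) F p);
    last exact: energy_continuous.
  apply: cvgZ; first exact: cvg_fst.
  apply: cvgD; first exact: cvg_cst.
  by apply: cvgZr_tmp; exact: cvg_snd.
pose B := (`[0, 1] `*` `[0, 1]) `&` [set p : R * R | 0 <= F (p.1 *: zt p.2)].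
have cB : compact B.
  apply: compact_closedI; first by apply: compact_setX; exact: segment_compact.
  by apply: preimage_closed (@closed_ge R 0) => p _; exact: cG.
have [||[lam s] /set_mem [[/= lam01 s01] Fp] hmin] :=
    @compact_EVT_min _ R (fun p : R * R => p.1) B _ cB.
- exists (1, t); split; last by rewrite /= scale1r.
  by split; rewrite /= in_itv /= ?lexx ?ler01 ?t0 ?t1.
- by apply: continuous_subspaceT => p; exact: cvg_fst.
move: lam01 s01; rewrite !in_itv /= => /andP[lam0 lam1] /andP[s0 s1].
have lamlt (mu u : R) : 0 <= mu -> mu < lam -> 0 <= u -> u <= 1 -> F (mu *: zt u) < 0.
  move=> mu0 mulam u0 u1; rewrite ltNge; apply/negP => Fmu.
  have /hmin /= : (mu, u) \in B.
    apply/mem_set; split => //; split; rewrite /= in_itv /= ?u0 ?u1 //.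
    by rewrite mu0 (le_trans (ltW mulam)).
  by rewrite leNgt mulam.
have lamp : 0 < lam.
  rewrite lt_neqAle lam0 andbT; apply/eqP => h; move: Fp.
  by rewrite -h scale0r /energy_fun action0 expr0n mulr0 /=; lra.
have Fle (u : R) : 0 <= u -> u <= 1 -> F (lam *: zt u) <= 0.
  move=> u0 u1.
  have [//|Fu] := lerP (F (lam *: zt u)) 0.
  have : {for lam, continuous (fun mu : R => F (mu *: zt u))}.
    apply: (@continuous_comp _ _ _ (fun mu : R => mu *: zt u) F lam);
      last exact: energy_continuous.
    by apply: cvgZr_tmp; exact: cvg_id.
  move=> /cvgr_gt /(_ _ Fu) h.
  have : \forall mu \near lam^'-, [/\ 0 < F (mu *: zt u), 0 < mu & mu < lam].
    near=> mu; split.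
    - by near: mu; apply: cvg_within; exact: h.
    - by near: mu; exact: nbhs_left_gt.
    - by near: mu; exact: nbhs_left_lt.
  by move=> /filter_ex [mu [h1 h2 h3]]; move: (lamlt _ _ (ltW h2) h3 u0 u1); lra.
have F0 : F (lam *: zt s) = 0 by apply/eqP; rewrite eq_le Fp Fle.
(* the touching point lies on S, in the interior of the segment *)
have Sw : S (lam *: zt s).
  split=> //; rewrite actionZ.
  have := Llt s s0 s1; have := action_ge0 (zt s).
  have : lam ^+ 2 <= 1 by rewrite exprn_ile1.
  nra.
have Fend z : action z < 1 -> F z < 0 -> lam *: zt s <> lam *: z.
  move=> Lz Fz h; move: F0; rewrite h.
  have [->|lamn1] := eqVneq lam 1; first by rewrite scale1r; lra.
  have := energy_star hC Lz (ltW Fz) lam0; rewrite lt_neqAle lamn1 lam1 => /(_ isT).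
  lra.
have sp : 0 < s.
  rewrite lt_neqAle s0 andbT; apply/eqP => h; apply: (Fend z1) => //.
  by rewrite /zt -h scale0r addr0.
have sl : s < 1.
  rewrite lt_neqAle s1 andbT; apply/eqP => h; apply: (Fend z2) => //.
  by rewrite /zt h scale1r addrC subrK.
have [h|v0] := eqVneq (lam *: (z2 - z1)) 0.
  apply: (Fend z1) => //; move/eqP : h; rewrite scaler_eq0 gt_eqF //= => /eqP h.
  by rewrite /zt h scaler0 addr0.
(* F is maximal at the touching point along the shrunken segment *)
pose e := Num.min s (1 - s).
have e0 : 0 < e by rewrite lt_min sp subr_gt0.
have [|d0 dd0] := @energy_max (lam *: zt s) (lam *: (z2 - z1)) e e0.
  move=> u; rewrite lt_min ltr_norml => /andP[/andP[u1 u2]].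
  rewrite ltr_norml => /andP[u3 u4]; rewrite F0.
  rewrite scalerA mulrC -scalerA -scalerDr.
  rewrite (_ : zt s + u *: _ = zt (s + u)); last by rewrite /zt scalerDl addrA.
  by apply: Fle; lra.
by have := ddenergy_gt0 hC Sw v0 d0; rewrite ltNge dd0.
Unshelve. all: by end_near. Qed.

End ConvexSurface.

(** * Compactness and curvature *)

Section ClosedHypersurface.
Variables (R : realType) (C : R).
Local Notation R4 := 'rV[R]_(2 + 2).
Implicit Types (z v w : R4).
Local Notation F := (energy_fun C).
Local Notation S := (regularized_surface C).
Local Notation K := (regularized_domain C).

Lemma open_preimage_lt (T : topologicalType) (f : T -> R) (a : R) :
  continuous f -> open [set z | f z < a].
Proof. by move=> cf; apply: open_comp (@open_lt _ a) => z _; exact: cf. Qed.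

Lemma open_preimage_gt (T : topologicalType) (f : T -> R) (a : R) :
  continuous f -> open [set z | a < f z].
Proof. by move=> cf; apply: open_comp (@open_gt _ a) => z _; exact: cf. Qed.

Lemma closed_preimage_le (T : topologicalType) (f : T -> R) (a : R) :
  continuous f -> closed [set z | f z <= a].
Proof. by move=> cf; apply: preimage_closed (@closed_le _ a) => z _; exact: cf. Qed.

Lemma domain_open : open K.
Proof.
apply: openI; first exact/open_preimage_lt/action_continuous.
exact/open_preimage_lt/energy_continuous.
Qed.

(** Every point z of S is the limit of the points t z of K for t -> 1; on the
other hand F is positive where L = 1, so that closing K does not produce such
points. *)
Lemma surface_closureD : 3 / 2 < C -> S = closure K `\` K.
Proof.
move=> hC; apply/seteqP; split=> z.
  move=> [L1 F0]; split; last by move=> [_]; rewrite F0 ltxx.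
  move=> A Az.
  have : {for 1, continuous (fun t : R => t *: z)}.
    by apply: cvgZr_tmp; exact: cvg_id.
  rewrite /prop_for /continuous_at scale1r => /(_ A Az) h.
  have : \forall t \near 1^'-, [/\ A (t *: z), 0 < t & t < 1].
    near=> t; split.
    - by near: t; apply: cvg_within; exact: h.
    - by near: t; exact: nbhs_left_gt.
    - by near: t; exact: nbhs_left_lt.
  move=> /filter_ex [t [At t0 t1]]; exists (t *: z); split => //; split.
    rewrite actionZ; have : t ^+ 2 < 1 by rewrite exprn_ilt1 // ltW.
    have := action_ge0 z; nra.
  by apply: energy_star => //; rewrite ?F0 // ltW.
move=> [clK nK].
have Dcl : closed ([set w : R4 | action w <= 1] `&` [set w | F w <= 0]).
  apply: closedI; first exact/closed_preimage_le/action_continuous.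
  exact/closed_preimage_le/energy_continuous.
have [L1 F0] : ([set w : R4 | action w <= 1] `&` [set w | F w <= 0]) z.
  apply: Dcl; apply: closure_subset clK => w [/ltW ? /ltW ?]; by split.
have Ll := energy_at_action1 hC L1 F0.
split=> //; apply/eqP; rewrite eq_le F0 /= leNgt; apply/negP => Fz.
exact: nK.
Unshelve. all: by end_near. Qed.

Lemma coord_bound z : action z < 1 -> `|z| <= 2.
Proof.
move=> L1; rewrite [leLHS]/Num.Def.normr /= mx_normrE.
apply: bigmax_le => // -[i j] _ /=; rewrite ord1 {i}.
rewrite -[leRHS]ger0_norm // -ler_sqr ?nnegrE // !real_normK ?num_real //.
have h1 := sqr_ge0 (x1 z); have h2 := sqr_ge0 (x2 z).
have h3 := sqr_ge0 (y1 z); have h4 := sqr_ge0 (y2 z).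
move: L1; rewrite /action => L1.
by elim/ord4P : j; rewrite -?x1E -?x2E -?y1E -?y2E; lra.
Qed.

Lemma bounded_action (A : set R4) : (forall z, A z -> action z < 1) ->
  bounded_set A.
Proof.
move=> hA; exists 2; split; first exact: num_real.
by move=> M M2 z Az; apply: le_trans (coord_bound (hA z Az)) (ltW M2).
Qed.

Lemma surface_compact : 3 / 2 < C -> compact S.
Proof.
move=> hC; apply: bounded_closed_compact.
  by apply: bounded_action => z [].
rewrite surface_closureD // setDE; apply: closedI; first exact: closed_closure.
exact/open_closedC/domain_open.
Qed.

(** Differentiating in the radial direction shows that the gradient does not
vanish where 0 < L < 1. *)
Lemma denergy_radial z : denergy C z z = action z ^+ 2 * (4 * C - 6 * angmom z).
Proof.
have -> : denergy C z z = 2 * (C - angmom z) * action z * (2 * action z)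
    - 2 * angmom z * action z ^+ 2.
  by rewrite /denergy /action_polar /angmom_polar /action /angmom; field.
ring.
Qed.

(** A neighbourhood of S on which a single equation describes S. *)
Definition collar : set R4 := [set z | action z < 1] `&` [set z | 0 < action z].

Lemma collar_open : open collar.
Proof.
apply: openI; first exact/open_preimage_lt/action_continuous.
exact/open_preimage_gt/action_continuous.
Qed.

Lemma surface_collar z : S z -> collar z.
Proof. by move=> Sz; split; [case: Sz|exact: surface_action_gt0 Sz]. Qed.

Lemma grad_energy z v : dot (grad (F : 'rV[R]_3.+1 -> R) z) v = denergy C z v.
Proof.
rewrite dot_grad; last first.
  exact: smooth_differentiable (smooth_energy C openT) _.
exact: (congr1 (@^~ z) (derive_energy C v)).
Qed.

Lemma grad_energy_neq0 z : 3 / 2 < C -> collar z ->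
  grad (F : 'rV[R]_3.+1 -> R) z != 0.
Proof.
move=> hC [/= L1 L0]; apply/eqP => h.
have := grad_energy z z; rewrite h denergy_radial.
have -> : dot (0 : 'rV[R]_3.+1) z = 0.
  by rewrite /dot big1 // => i _; rewrite mxE mul0r.
move=> /esym/eqP; rewrite mulf_eq0 expf_eq0 /= gt_eqF //= => /eqP h4.
have := angmom_le z; lra.
Qed.

Lemma energy_local_equation : 3 / 2 < C -> local_equation S collar F.
Proof.
move=> hC; split.
- exact: collar_open.
- exact/smooth_energy/collar_open.
- apply/seteqP; split=> z; first by move=> [[L1 F0] cz].
  by move=> [[L1 L0] F0].
- by move=> z [_]; exact: grad_energy_neq0.
Qed.

Lemma tangent_surface z v : tangent S z v -> denergy C z v = 0.
Proof.
move=> [gamma [g0 [I [oI I0 sg gS]]] <-].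
have dg : derivable gamma 0 1 by apply/diff_derivable/smooth_differentiable.
have [_ <-] : is_derive (0 : R) 1 (fun t => F (gamma t)) (denergy C z (derive1 gamma 0)).
  by rewrite derive1E -g0; exact: dir_energy.
rewrite -[RHS](derive_cst (0 : R) (0 : R) 1); apply: near_eq_derive.
by have := open_nbhs_nbhs (conj oI I0); apply: filterS => t /gS [_ ->].
Qed.

Lemma surface_curvature z v : 3 / 2 < C -> S z -> tangent S z v -> v != 0 ->
  0 < second_fundamental_form (F : 'rV[R]_3.+1 -> R) z v v.
Proof.
move=> hC Sz Tv v0; have dF0 := tangent_surface Tv.
have cz := surface_collar Sz.
rewrite (second_fundamental_form_tangent collar_open cz).
- rewrite [X in 0 < _ * X](derive2_energy C z v) mulr_gt0 //; last exact: ddenergy_gt0.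
  by rewrite invr_gt0 sqrtr_gt0 dot_gt0 // grad_energy_neq0.
- exact/smooth_energy/collar_open.
- by move=> w; exact: grad_energy_neq0.
- by rewrite -dF0; exact: (congr1 (@^~ z) (derive_energy C v)).
Qed.

End ClosedHypersurface.

(** * Connectedness and collisions *)

Lemma polar_angle (R : realType) (u v : R) : exists phi,
  u = Num.sqrt (u ^+ 2 + v ^+ 2) * cos phi /\
  v = Num.sqrt (u ^+ 2 + v ^+ 2) * sin phi.
Proof.
set r := Num.sqrt _.
have r2 : r ^+ 2 = u ^+ 2 + v ^+ 2 by rewrite sqr_sqrtr // addr_ge0 ?sqr_ge0.
have r0 : 0 <= r by exact: sqrtr_ge0.
have [rz|rn0] := eqVneq r 0.
  exists 0; move/eqP: r2; rewrite rz expr0n eq_sym paddr_eq0 ?sqr_ge0 // !sqrf_eq0.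
  by move=> /andP[/eqP -> /eqP ->]; rewrite !mul0r.
have rp : 0 < r by rewrite lt_neqAle eq_sym rn0.
pose c := u / r.
have c1 : -1 <= c <= 1.
  rewrite -ler_norml -[1](normr1 R) -ler_sqr ?nnegrE // !real_normK ?num_real //.
  rewrite expr1n /c expr_div_n ler_pdivrMr ?exprn_gt0 // mul1r r2 lerDl.
  exact: sqr_ge0.
have cK : cos (acos c) = c by apply: acosK; rewrite in_itv.
have uE : u = r * c by rewrite /c mulrC divfK.
have sE : Num.sqrt (1 - c ^+ 2) = `|v| / r.
  rewrite (_ : 1 - c ^+ 2 = (v / r) ^+ 2).
    by rewrite sqrtr_sqr normf_div (gtr0_norm rp).
  by rewrite /c !expr_div_n (_ : v ^+ 2 = r ^+ 2 - u ^+ 2); [field|rewrite r2; ring].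
have [v0|v0] := lerP 0 v.
  exists (acos c); rewrite cK -uE; split=> //.
  by rewrite sin_acos // sE ger0_norm // mulrC divfK.
exists (- acos c); rewrite cosN sinN cK -uE; split=> //.
by rewrite sin_acos // sE ltr0_norm // mulNr opprK mulrC divfK.
Qed.

Section Connected.
Variables (R : realType) (C : R).
Local Notation R4 := 'rV[R]_(2 + 2).
Implicit Types (z v w : R4).
Local Notation F := (energy_fun C).
Local Notation S := (regularized_surface C).
Local Notation K := (regularized_domain C).

(** The squared lengths of the two components of a point of S as functions of L,
because J = C - 1 / (2 L^2) on S. *)
Definition torus_A (l : R) := l + (l ^- 2) / 2 - C.
Definition torus_B (l : R) := l - (l ^- 2) / 2 + C.

(** The point whose components in the two invariant planes have lengths a, b and
arguments phi, psi. *)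
Definition torus_pt (a b phi psi : R) : R4 :=
  coord4 (a * cos phi + b * cos psi) (a * sin phi + b * sin psi)
         (a * sin phi - b * sin psi) (b * cos psi - a * cos phi).

Definition arc_range : set R :=
  [set l | [/\ 0 < l, l < 1, 0 <= torus_A l & 0 <= torus_B l]].

Lemma torus_action a b phi psi : action (torus_pt a b phi psi) = (a ^+ 2 + b ^+ 2) / 2.
Proof.
rewrite /action /torus_pt !coord4E.
have h1 := cos2Dsin2 phi; have h2 := cos2Dsin2 psi.
rewrite (_ : _ / 4 = (a ^+ 2 * (cos phi ^+ 2 + sin phi ^+ 2) +
  b ^+ 2 * (cos psi ^+ 2 + sin psi ^+ 2)) / 2); last by field.
by rewrite h1 h2 !mulr1.
Qed.

Lemma torus_angmom a b phi psi : angmom (torus_pt a b phi psi) = (b ^+ 2 - a ^+ 2) / 2.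
Proof.
rewrite /angmom /torus_pt !coord4E.
have h1 := cos2Dsin2 phi; have h2 := cos2Dsin2 psi.
rewrite (_ : _ / 2 = (b ^+ 2 * (cos psi ^+ 2 + sin psi ^+ 2) -
  a ^+ 2 * (cos phi ^+ 2 + sin phi ^+ 2)) / 2); last by field.
by rewrite h1 h2 !mulr1.
Qed.

Lemma torus_surface l phi psi : arc_range l ->
  S (torus_pt (Num.sqrt (torus_A l)) (Num.sqrt (torus_B l)) phi psi).
Proof.
move=> [l0 l1 A0 B0].
have L : action (torus_pt (Num.sqrt (torus_A l)) (Num.sqrt (torus_B l)) phi psi) = l.
  by rewrite torus_action !sqr_sqrtr // /torus_A /torus_B; field; rewrite gt_eqF.
apply: surfaceP; rewrite ?L //.
by rewrite torus_angmom !sqr_sqrtr // /torus_A /torus_B; field; rewrite gt_eqF.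
Qed.

Lemma surface_torus z : S z -> arc_range (action z) /\
  exists phi psi, z = torus_pt (Num.sqrt (torus_A (action z)))
    (Num.sqrt (torus_B (action z))) phi psi.
Proof.
move=> Sz; have L0 := surface_action_gt0 Sz; have hJ := surfaceE Sz.
have L1 : action z < 1 by case: Sz.
have eA : torus_A (action z) = ((x1 z - y2 z) / 2) ^+ 2 + ((x2 z + y1 z) / 2) ^+ 2.
  rewrite /torus_A -hJ /action /angmom; by field.
have eB : torus_B (action z) = ((x1 z + y2 z) / 2) ^+ 2 + ((x2 z - y1 z) / 2) ^+ 2.
  rewrite /torus_B -hJ /action /angmom; by field.
split; first by split=> //; rewrite ?eA ?eB addr_ge0 ?sqr_ge0.
have [phi [p1 p2]] := polar_angle ((x1 z - y2 z) / 2) ((x2 z + y1 z) / 2).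
have [psi [q1 q2]] := polar_angle ((x1 z + y2 z) / 2) ((x2 z - y1 z) / 2).
exists phi, psi; rewrite eA eB /torus_pt -p1 -p2 -q1 -q2.
by apply: coord4P; rewrite coord4E; field.
Qed.

(** On 0 < L < 1 the function L - J decreases and L + J increases, so the
condition that both be nonnegative cuts out an interval. *)
Lemma arc_range_interval : is_interval arc_range.
Proof.
move=> l1 l2 [l10 l11 A1 B1] [l20 l21 A2 B2] l /andP[l1l ll2].
have l0 : 0 < l by exact: lt_le_trans l1l.
have ll1 : l < 1 by exact: le_lt_trans l21.
have inv_le (a b : R) : 0 < a -> a <= b -> b ^- 2 <= a ^- 2.
  move=> a0 ab; rewrite lef_pV2 ?posrE ?exprn_gt0 //; last exact: lt_le_trans ab.
  by rewrite ler_sqr ?nnegrE // ltW // (lt_le_trans a0).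
split=> //; last by move: B1 (inv_le _ _ l10 l1l); rewrite /torus_B; lra.
apply: le_trans A2 _; rewrite -subr_ge0.
rewrite (_ : _ - _ = (l2 - l) * ((l + l2) / 2 * (l ^- 2 * l2 ^- 2) - 1)); last first.
  by rewrite /torus_A; field; rewrite !gt_eqF.
rewrite mulr_ge0 ?subr_ge0 // -invfM ler_pdivlMr ?mulr_gt0 ?exprn_gt0 // mul1r.
rewrite ler_pdivlMr //.
have h1 : l ^+ 2 * l2 ^+ 2 <= l2 ^+ 2 by rewrite ler_piMl ?sqr_ge0 // exprn_ile1 // ltW.
have h2 : l2 ^+ 2 * l ^+ 2 <= l ^+ 2 by rewrite ler_piMl ?sqr_ge0 // exprn_ile1 // ltW.
have h3 : l ^+ 2 <= l by rewrite expr2 ler_piMl // ltW.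
have h4 : l2 ^+ 2 <= l2 by rewrite expr2 ler_piMl // ltW.
by rewrite mulrDr mulr1; lra.
Qed.

Lemma continuous_coord4 (T : topologicalType) (a b c d : T -> R) t :
  {for t, continuous a} -> {for t, continuous b} ->
  {for t, continuous c} -> {for t, continuous d} ->
  {for t, continuous (fun s => coord4 (a s) (b s) (c s) (d s))}.
Proof.
move=> ca cb cc cd.
have -> : (fun s => coord4 (a s) (b s) (c s) (d s)) = (fun s =>
    a s *: coord4 1 0 0 0 + b s *: coord4 0 1 0 0
    + (c s *: coord4 0 0 1 0 + d s *: coord4 0 0 0 1)).
  by apply/funext => s; apply: coord4P; rewrite !coordDZ !coord4E; ring.
by apply: cvgD; apply: cvgD; apply: cvgZr_tmp.
Qed.

Lemma arc_continuous l : 0 < l ->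
  {for l, continuous (fun l => torus_pt (Num.sqrt (torus_A l)) (Num.sqrt (torus_B l)) 0 0)}.
Proof.
move=> l0.
have ci : {for l, continuous (fun l : R => l ^- 2 / 2)}.
  apply: cvgM; last exact: cvg_cst.
  apply: cvgV; first by rewrite expf_neq0 // gt_eqF.
  exact: exprn_continuous.
have cA : {for l, continuous (fun l => Num.sqrt (torus_A l))}.
  apply: (@continuous_comp _ _ _ torus_A Num.sqrt); last exact: sqrt_continuous.
  by apply: cvgB; [apply: cvgD => //; exact: cvg_id|exact: cvg_cst].
have cB : {for l, continuous (fun l => Num.sqrt (torus_B l))}.
  apply: (@continuous_comp _ _ _ torus_B Num.sqrt); last exact: sqrt_continuous.
  by apply: cvgD; [apply: cvgB => //; exact: cvg_id|exact: cvg_cst].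
by apply: continuous_coord4; [apply: cvgD|apply: cvgD|apply: cvgB|apply: cvgB];
  apply: cvgM => //; exact: cvg_cst.
Qed.

Lemma rotation_continuous a b phi psi t :
  {for t, continuous (fun t : R => torus_pt a b (t * phi) (t * psi))}.
Proof.
have cl (c : R) : {for t, continuous (fun s : R => s * c)}.
  by apply: cvgM; [exact: cvg_id|exact: cvg_cst].
have cc (c : R) : {for t, continuous (fun s : R => cos (s * c))}.
  by apply: (@continuous_comp _ _ _ (fun s : R => s * c) cos) => //; exact: continuous_cos.
have cs (c : R) : {for t, continuous (fun s : R => sin (s * c))}.
  by apply: (@continuous_comp _ _ _ (fun s : R => s * c) sin) => //; exact: continuous_sin.
by apply: continuous_coord4; [apply: cvgD|apply: cvgD|apply: cvgB|apply: cvgB];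
  apply: cvgM => //; (try exact: cvg_cst); (exact: cc || exact: cs).
Qed.

(** The torus orbits of S all meet the arc phi = psi = 0, whose points are
parametrized by L. *)
Lemma surface_connected : connected S.
Proof.
have [[z0 Sz0]|/forallNP S0] := pselect (S !=set0); last first.
  have -> : S = set0 by apply/seteqP; split=> // z /S0.
  exact: connected0.
pose pt l phi psi := torus_pt (Num.sqrt (torus_A l)) (Num.sqrt (torus_B l)) phi psi.
pose arc : set R4 := (fun l => pt l 0 0) @` arc_range.
have carc : connected arc.
  apply: connected_continuous_connected.
    exact/connected_intervalP/arc_range_interval.
  apply: continuous_in_subspaceT => l /set_mem [l0 _ _ _].
  exact: arc_continuous.
pose orb (l phi psi : R) : set R4 := (fun t => pt l (t * phi) (t * psi)) @` setT.
have corb l phi psi : connected (orb l phi psi).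
  apply: connected_continuous_connected; first exact/connected_intervalP.
  by apply: continuous_subspaceT => t; exact: rotation_continuous.
have -> : S = \bigcup_(p in [set p : R * R * R | arc_range p.1.1])
    (arc `|` orb p.1.1 p.1.2 p.2).
  apply/seteqP; split=> z.
    move=> /surface_torus [ar [phi [psi ez]]].
    exists (action z, phi, psi) => //; right; exists 1 => //.
    by rewrite !mul1r.
  move=> [[[l phi] psi] /= lr [[l' l'r <-]|[t _ <-]]]; exact: torus_surface.
apply: bigcup_connected.
  have [ar _] := surface_torus Sz0.
  exists (pt (action z0) 0 0) => p _; left; by exists (action z0).
move=> [[l phi] psi] /= lr; apply: connectedU => //.
exists (pt l 0 0); split; first by exists l.
by exists 0 => //; rewrite !mul0r.
Qed.

(** This rotation preserves L and J, hence S, and moves a nonzero point with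
x = 0 off the plane x = 0 at once. *)
Definition hopf_rotation (t : R) z : R4 :=
  coord4 (cos t * x1 z + sin t * y1 z) (cos t * x2 z + sin t * y2 z)
         (cos t * y1 z - sin t * x1 z) (cos t * y2 z - sin t * x2 z).

Lemma hopf_rotation_surface t z : S z -> S (hopf_rotation t z).
Proof.
have h1 := cos2Dsin2 t.
have eL : action (hopf_rotation t z) = action z.
  rewrite /action /hopf_rotation !coord4E.
  rewrite (_ : _ / 4 = (cos t ^+ 2 + sin t ^+ 2) * action z); last first.
    by rewrite /action; field.
  by rewrite h1 mul1r.
have eJ : angmom (hopf_rotation t z) = angmom z.
  rewrite /angmom /hopf_rotation !coord4E.
  rewrite (_ : _ / 2 = (cos t ^+ 2 + sin t ^+ 2) * angmom z); last first.
    by rewrite /angmom; field.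
  by rewrite h1 mul1r.
by move=> [L1 F0]; split; rewrite /energy_fun eL ?eJ.
Qed.

Definition collisions : set R4 := S `&` [set z | pos z = 0].

Lemma collisionsP z : pos z = 0 <-> x1 z = 0 /\ x2 z = 0.
Proof.
split; first by rewrite /x1 /x2 => ->; rewrite !mxE.
by move=> [h1 h2]; apply: row2P; rewrite [RHS]mxE.
Qed.

Lemma smooth_radius2 (U : set R4) : open U ->
  smooth_on U (fun z => x1 z ^+ 2 + x2 z ^+ 2).
Proof.
move=> oU; apply: smoothD => //; apply: smoothX => //; first exact: smooth_x1.
exact: smooth_x2.
Qed.

Lemma radius2_eq0 z : (x1 z ^+ 2 + x2 z ^+ 2 == 0) = (pos z == 0).
Proof.
rewrite paddr_eq0 ?sqr_ge0 // !sqrf_eq0; apply/andP/eqP.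
  by move=> [/eqP h1 /eqP h2]; apply/collisionsP.
by move=> /collisionsP [-> ->].
Qed.

Lemma collisions_closed : 3 / 2 < C -> closed collisions.
Proof.
move=> hC; apply: closedI.
  by apply: compact_closed; [exact: norm_hausdorff|exact: surface_compact].
rewrite (_ : [set z | pos z = 0] = [set z : R4 | x1 z ^+ 2 + x2 z ^+ 2 <= 0]).
  apply: closed_preimage_le => z.
  exact: smooth_continuous (smooth_radius2 openT) _.
apply/seteqP; split=> z /=.
  by move/eqP; rewrite -radius2_eq0 => /eqP ->.
by move=> h; apply/eqP; rewrite -radius2_eq0 eq_le h addr_ge0 ?sqr_ge0.
Qed.

Lemma collisions_nowhere_dense : 3 / 2 < C -> nowhere_dense_in collisions S.
Proof.
move=> hC U oU [z [Sz Uz]] /(_ _) sub.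
have clC := (closure_id _).1 (collisions_closed hC).
rewrite -clC in sub.
have [_ /collisionsP [z1 z2]] := sub z (conj Sz Uz).
have c0 : {for 0, continuous (fun t : R => hopf_rotation t z)}.
  by apply: continuous_coord4; [apply: cvgD|apply: cvgD|apply: cvgB|apply: cvgB];
    (apply: cvgM; last exact: cvg_cst); (exact: continuous_cos || exact: continuous_sin).
have r0 : hopf_rotation 0 z = z.
  by apply: coord4P; rewrite coord4E cos0 sin0; ring.
have nU : nbhs (hopf_rotation 0 z) U by rewrite r0; exact: open_nbhs_nbhs.
have h := c0 _ nU.
have /nbhs_ballP [e /= e0 he] := h.
pose t := Num.min (e / 2) 1.
have t0 : 0 < t by rewrite lt_min ltr01 divr_gt0.
have te : t < e by rewrite gt_min ltr_pdivrMr // ltr_pMr // ltr1n.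
have t2 : t < 2 by rewrite gt_min ltr1n orbT.
have Ut : U (hopf_rotation t z).
  by apply: he; rewrite /ball /= sub0r normrN gtr0_norm.
have st : sin t != 0 by rewrite gt_eqF // sin2_gt0 // t0.
have [_ /collisionsP []] := sub _ (conj (hopf_rotation_surface t Sz) Ut).
rewrite !coord4E z1 z2 !mulr0 !add0r => /eqP; rewrite mulf_eq0 (negPf st) /=.
move=> /eqP y10 /eqP; rewrite mulf_eq0 (negPf st) /= => /eqP y20.
have := surface_action_gt0 Sz; rewrite /action z1 z2 y10 y20 !expr0n !addr0 mul0r.
by rewrite ltxx.
Qed.

Lemma surface_closed_strictly_convex : 3 / 2 < C ->
  closed_strictly_convex_hypersurface S.
Proof.
move=> hC; have lS := energy_local_equation hC.
split; [exact: surface_compact|exact: surface_connected| |].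
  by move=> z /surface_collar cz; exists (@collar R), F; split.
exists K; split.
  split.
  - exact: domain_open.
  - exists 0; split; first by rewrite /= action0.
    by rewrite /energy_fun action0 expr0n mulr0 /=; lra.
  - by apply: bounded_action => z [].
  - move=> z w t /set_mem Kz /set_mem Kw; apply/mem_set.
    have t0 : 0 <= t%:num by exact: ge0.
    have t1 : t%:num <= 1 by exact: le1.
    change (K (t%:num *: (z : R4) + (1 - t%:num) *: (w : R4))).
    have -> : t%:num *: (z : R4) + (1 - t%:num) *: (w : R4) =
        (z : R4) + (1 - t%:num) *: ((w : R4) - (z : R4)).
      by apply: coord4P; rewrite -[- (z : R4)]scaleN1r !coordDZ; ring.
    by apply: domain_convex => //; rewrite ?subr_ge0 // gerBl.
  - exact: surface_closureD.
move=> z Sz; exists (@collar R), F; split.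
- exact: surface_collar Sz.
- exact: energy_local_equation.
- apply/seteqP; split=> w; first by move=> [[L1 F0] cw].
  by move=> [[L1 L0] F0].
- by move=> v; exact: surface_curvature.
Qed.

End Connected.

(** * The bounded component of the Hill's region *)

Section HillRegion.
Variable R : realType.
Local Notation R4 := 'rV[R]_(2 + 2).
Local Notation R2 := 'rV[R]_2.
Implicit Types (q : R2) (z : R4) (c : R).

Lemma enorm2E q : enorm (q : 'rV[R]_1.+1) = Num.sqrt (q 0 0 ^+ 2 + q 0 1 ^+ 2).
Proof. by rewrite /enorm /dot sum2 -!expr2. Qed.

Lemma enorm2_gt0 q : (0 < enorm (q : 'rV[R]_1.+1)) = (q != 0).
Proof.
apply/idP/idP => [|q0]; last by rewrite sqrtr_gt0 dot_gt0.
apply: contraTneq => ->; rewrite enorm2E !mxE.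
by rewrite expr0n addr0 sqrtr0 ltxx.
Qed.

Lemma enorm2Z (a : R) q : enorm (a *: q : 'rV[R]_1.+1) = `|a| * enorm (q : 'rV[R]_1.+1).
Proof.
by rewrite !enorm2E !mxE !exprMn -mulrDr sqrtrM ?sqr_ge0 // sqrtr_sqr.
Qed.

Lemma enorm2_continuous : continuous (fun q => enorm (q : 'rV[R]_1.+1)).
Proof.
move=> q; rewrite /continuous_at enorm2E.
under eq_fun do rewrite enorm2E.
apply: (@continuous_comp _ _ _ (fun q : R2 => q 0 0 ^+ 2 + q 0 1 ^+ 2) Num.sqrt);
  last exact: sqrt_continuous.
have sq (j : 'I_2) : {for q, continuous (fun q : R2 => q 0 j ^+ 2)}.
  by apply: (@continuous_comp _ _ _ (fun q : R2 => q 0 j) (fun t : R => t ^+ 2));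
    [exact: coord_continuous|exact: exprn_continuous].
exact: (continuousD (sq 0) (sq 1)).
Qed.

Lemma norm_le_enorm2 q : `|q| <= enorm (q : 'rV[R]_1.+1).
Proof.
rewrite [leLHS]/Num.Def.normr /= mx_normrE.
apply: bigmax_le => [|[i j] _ /=]; first exact: sqrtr_ge0.
rewrite ord1 {i} enorm2E -sqrtr_sqr ler_wsqrtr //.
case: j => [[|[|//]]] lt_j.
  by rewrite (_ : Ordinal _ = 0) ?lerDl ?sqr_ge0 //; exact: val_inj.
by rewrite (_ : Ordinal _ = 1) ?lerDr ?sqr_ge0 //; exact: val_inj.
Qed.

(** The Hill's region omits the circle |q| = 1, because the potential has the
value - 3/2 there. A component that contains a point with |q| < 1 therefore
stays in the unit disc, and a point with |q| > 1 can be moved to infinity along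
its ray, on which the potential decreases. *)
Lemma bounded_hill_regionP c q : c < - (3 / 2) ->
  bounded_hill_region c q <->
  [/\ q != 0, effective_potential q <= c & enorm (q : 'rV[R]_1.+1) < 1].
Proof.
move=> hc; set r := enorm _; rewrite /bounded_hill_region.
split=> [[[q0 Uq] bq]|[q0 Uq r1]].
  split=> //; rewrite ltNge; apply/negP => r1.
  have rp : 0 < r by rewrite enorm2_gt0.
  (* the ray from q to infinity stays in the Hill's region *)
  pose ray : set R2 := (fun t : R => t *: q) @` [set t | 1 <= t].
  have cray : connected ray.
    apply: connected_continuous_connected.
      apply/connected_intervalP => a b /= a1 b1 t /andP[a_t _].
      exact: le_trans a_t.
    apply: continuous_subspaceT => t.
    by apply: cvgZr_tmp; exact: cvg_id.
  have rayq : ray q by exists 1; rewrite /= ?lexx ?scale1r.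
  have rayh : ray `<=` hill_region c.
    move=> _ [t /= t1 <-]; have t0 : 0 < t by exact: lt_le_trans t1.
    split; first by rewrite scaler_eq0 gt_eqF.
    apply: le_trans Uq; rewrite /effective_potential enorm2Z gtr0_norm // -/r.
    rewrite -subr_ge0 (_ : _ - _ = (t - 1) / (2 * t * r) *
      (t * r ^+ 3 * (t + 1) - 2)); last first.
      by field; rewrite !gt_eqF.
    apply: mulr_ge0; first by rewrite divr_ge0 ?subr_ge0 // ltW // !mulr_gt0.
    have r3 : 1 <= r ^+ 3 by rewrite exprn_ege1.
    have h1 : 1 <= t * r ^+ 3 by rewrite mulr_ege1.
    have : 0 <= (t * r ^+ 3 - 1) * (t + 1) by rewrite mulr_ge0; lra.
    lra.
  have raycomp := connected_component_max rayq rayh cray.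
  have [M [_ hM]] := bq.
  pose M' := Num.max M 1 + 1.
  have MM' : M < M' by rewrite ltr_pwDr // le_max lexx.
  have M'1 : 1 <= M' by rewrite ler_wpDr // le_max lexx orbT.
  have nq : 0 < `|q| by rewrite normr_gt0.
  pose t := Num.max 1 ((M' + 1) / `|q|).
  have rt : ray (t *: q) by exists t; rewrite //= le_max lexx.
  have : `|t *: q| <= M' := hM _ MM' _ (raycomp _ rt).
  rewrite normrZ ger0_norm ?le_max ?ler01 //.
  rewrite -ler_pdivlMr // leNgt => /negP; apply.
  by rewrite lt_max ltr_pM2r ?invr_gt0 // ltrDl ltr01 orbT.
split; first by split.
exists 1; split; first exact: num_real.
move=> M M1 p Cp; apply: le_trans (ltW M1); apply: le_trans (norm_le_enorm2 p) _.
rewrite leNgt; apply/negP => p1.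
have cc := @component_connected _ (hill_region c) q.
have ci : connected ((fun q => enorm (q : 'rV[R]_1.+1)) @` connected_component (hill_region c) q).
  apply: connected_continuous_connected => //.
  by apply: continuous_subspaceT; exact: enorm2_continuous.
have /connected_intervalP ii := ci.
have Cq : connected_component (hill_region c) q q.
  by apply: connected_component_refl.
(* a component reaching |q| >= 1 would meet the circle |q| = 1 *)
have [w Cw ew] : ((fun q => enorm (q : 'rV[R]_1.+1)) @` connected_component (hill_region c) q) 1.
  apply: (ii r (enorm (p : 'rV[R]_1.+1))); first by exists q.
    by exists p.
  by rewrite (ltW r1) (ltW p1).
have [_] := connected_component_sub Cw.
by rewrite /effective_potential ew invr1 expr1n; lra.
Qed.

Lemma hamiltonianE z : hamiltonian z =
  (y1 z ^+ 2 + y2 z ^+ 2) / 2 - (enorm (pos z : 'rV[R]_1.+1))^-1 - 2 * angmom z.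
Proof.
rewrite /hamiltonian [enorm (mom z : 'rV[R]_1.+1)]enorm2E sqr_sqrtr ?addr_ge0 ?sqr_ge0 //.
move: (enorm _)^-1 => e.
by rewrite /angmom /x1 /x2 /y1 /y2; field.
Qed.

Lemma enorm_pos z : enorm (pos z : 'rV[R]_1.+1) = Num.sqrt (x1 z ^+ 2 + x2 z ^+ 2).
Proof. exact: enorm2E. Qed.

Lemma bounded_energy_surfaceP c z : c < - (3 / 2) ->
  bounded_energy_surface c z <->
  [/\ pos z != 0, hamiltonian z = c & enorm (pos z : 'rV[R]_1.+1) < 1].
Proof.
move=> hc; split=> [[[q0 H] /= /(bounded_hill_regionP _ hc) [_ _]]//|[q0 H r1]].
split=> //; apply/(bounded_hill_regionP _ hc); split=> //.
rewrite -H -subr_ge0 hamiltonianE /effective_potential.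
rewrite (_ : _ - _ = ((y1 z + x2 z) ^+ 2 + (y2 z - x1 z) ^+ 2) / 2).
  by rewrite divr_ge0 // addr_ge0 ?sqr_ge0.
rewrite [in X in _ - (_ - X / 2)]enorm_pos sqr_sqrtr ?addr_ge0 ?sqr_ge0 //.
rewrite /angmom; field; by rewrite gt_eqF // enorm2_gt0.
Qed.

End HillRegion.

(** * The regularizing map and its fibres *)

Section Regularization.
Variable R : realType.
Local Notation R4 := 'rV[R]_(2 + 2).
Implicit Types (z : R4) (a b : R).

Definition radius2 z := x1 z ^+ 2 + x2 z ^+ 2.
Definition mom2 z := y1 z ^+ 2 + y2 z ^+ 2.
Definition qp z := x1 z * y1 z + x2 z * y2 z.
Definition dist z := Num.sqrt (radius2 z).

Definition rotate (t : R) z : R4 :=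
  coord4 (cos t * x1 z - sin t * x2 z) (sin t * x1 z + cos t * x2 z)
         (cos t * y1 z - sin t * y2 z) (sin t * y1 z + cos t * y2 z).

(** (u, w) with u = L x^2 / 2 and w = x y / (L |x|^2) as complex numbers; w is
also y / (L conj(x)). *)
Definition scaled_lc z : R4 :=
  coord4 (action z / 2 * (x1 z ^+ 2 - x2 z ^+ 2)) (action z * (x1 z * x2 z))
         ((y1 z * x1 z - y2 z * x2 z) / (action z * radius2 z))
         ((y1 z * x2 z + y2 z * x1 z) / (action z * radius2 z)).

(** The angle t for which - t dL / L^3 cancels <x, y> dL / (2 L). *)
Definition lc_angle z := action z ^+ 2 * qp z / 2.

Definition regularization z : R4 := rotate (lc_angle z) (scaled_lc z).

Lemma radius2_rotate t z : radius2 (rotate t z) = radius2 z.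
Proof. by rewrite /radius2 /rotate !coord4E -[RHS]mul1r -(cos2Dsin2 t); ring. Qed.
Lemma mom2_rotate t z : mom2 (rotate t z) = mom2 z.
Proof. by rewrite /mom2 /rotate !coord4E -[RHS]mul1r -(cos2Dsin2 t); ring. Qed.
Lemma qp_rotate t z : qp (rotate t z) = qp z.
Proof. by rewrite /qp /rotate !coord4E -[RHS]mul1r -(cos2Dsin2 t); ring. Qed.
Lemma angmom_rotate t z : angmom (rotate t z) = angmom z.
Proof.
by rewrite /angmom /rotate !coord4E -[RHS]mul1r -[X in _ = X * _](cos2Dsin2 t); field.
Qed.

Lemma rotateK t z : rotate (- t) (rotate t z) = z.
Proof.
have h := cos2Dsin2 t.
apply: coord4P; rewrite /rotate !coord4E cosN sinN -[RHS]mul1r -h; ring.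
Qed.

Lemma rotateNK t z : rotate t (rotate (- t) z) = z.
Proof. by rewrite -{1}[t]opprK rotateK. Qed.

Lemma radius2_lc z : radius2 (scaled_lc z) = (action z * radius2 z / 2) ^+ 2.
Proof. by rewrite /radius2 /scaled_lc !coord4E; field. Qed.

Lemma action_radius2 z : 0 < radius2 z -> 0 < action z.
Proof.
move=> N0; rewrite divr_gt0 // ltr_wpDr //.
by rewrite addr_ge0 ?sqr_ge0.
Qed.

Lemma mom2_lc z : 0 < radius2 z ->
  mom2 (scaled_lc z) = mom2 z / (action z ^+ 2 * radius2 z).
Proof.
move=> N0; have L0 := action_radius2 N0.
rewrite /mom2 /scaled_lc !coord4E.
rewrite (_ : _ + _ = (radius2 z * (y1 z ^+ 2 + y2 z ^+ 2)) / (action z * radius2 z) ^+ 2).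
  by field; rewrite !gt_eqF.
rewrite !expr_div_n -mulrDl; congr (_ / _).
by rewrite /radius2; ring.
Qed.

Lemma qp_lc z : 0 < radius2 z -> qp (scaled_lc z) = qp z / 2.
Proof.
move=> N0; have L0 := action_radius2 N0.
have E : x1 z ^+ 2 + x2 z ^+ 2 != 0 by rewrite gt_eqF.
by rewrite /qp /scaled_lc !coord4E /radius2; field; rewrite E gt_eqF.
Qed.

Lemma angmom_lc z : 0 < radius2 z -> angmom (scaled_lc z) = angmom z / 2.
Proof.
move=> N0; have L0 := action_radius2 N0.
have E : x1 z ^+ 2 + x2 z ^+ 2 != 0 by rewrite gt_eqF.
by rewrite /angmom /scaled_lc !coord4E /radius2; field; rewrite E gt_eqF.
Qed.

Lemma dist_regularization z : 0 < radius2 z ->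
  dist (regularization z) = action z * radius2 z / 2.
Proof.
move=> N0; rewrite /dist radius2_rotate radius2_lc sqrtr_sqr ger0_norm //.
by rewrite divr_ge0 // mulr_ge0 ?action_ge0 // ltW.
Qed.

(** Minus twice the Kepler energy, equal to L^-2. *)
Definition kepler z := 2 / dist z - mom2 z.

Lemma kepler_regularization z : 0 < radius2 z ->
  kepler (regularization z) = action z ^- 2.
Proof.
move=> N0; have L0 := action_radius2 N0.
rewrite /kepler dist_regularization // mom2_rotate mom2_lc //.
have -> : mom2 z = 4 * action z - radius2 z.
  by rewrite /mom2 /action /radius2; field.
by field; rewrite !gt_eqF.
Qed.

(** The action L and, below, the angle t as functions of (q, p). *)
Definition inv_action z := (Num.sqrt (kepler z))^-1.
Definition inv_angle z := inv_action z ^+ 2 * qp z.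
Definition unrotated z := rotate (- inv_angle z) z.
(** The real and imaginary parts and the modulus of x^2 = 2 e^(-it) q / L. *)
Definition square1 z := 2 * x1 (unrotated z) / inv_action z.
Definition square2 z := 2 * x2 (unrotated z) / inv_action z.
Definition square_abs z := 2 * dist z / inv_action z.

(** The point (x, y) with x = a + i b and y = L e^(-it) p conj(x). *)
Definition lc_lift z a b : R4 :=
  coord4 a b (inv_action z * (y1 (unrotated z) * a + y2 (unrotated z) * b))
             (inv_action z * (y2 (unrotated z) * a - y1 (unrotated z) * b)).

Lemma inv_action_regularization z : 0 < radius2 z ->
  inv_action (regularization z) = action z.
Proof.
move=> N0; have L0 := action_radius2 N0.
rewrite /inv_action kepler_regularization // -exprVn sqrtr_sqr ger0_norm ?invrK //.
by rewrite invr_ge0 ltW.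
Qed.

Lemma unrotated_regularization z : 0 < radius2 z ->
  unrotated (regularization z) = scaled_lc z.
Proof.
move=> N0; rewrite /unrotated {2}/regularization.
suff -> : inv_angle (regularization z) = lc_angle z by rewrite rotateK.
by rewrite /inv_angle inv_action_regularization // qp_rotate qp_lc // mulrA.
Qed.

Lemma square1_regularization z : 0 < radius2 z ->
  square1 (regularization z) = x1 z ^+ 2 - x2 z ^+ 2.
Proof.
move=> N0; have L0 := action_radius2 N0.
rewrite /square1 unrotated_regularization // inv_action_regularization //.
by rewrite coord4E; field; rewrite gt_eqF.
Qed.

Lemma square2_regularization z : 0 < radius2 z ->
  square2 (regularization z) = 2 * x1 z * x2 z.
Proof.
move=> N0; have L0 := action_radius2 N0.
rewrite /square2 unrotated_regularization // inv_action_regularization //.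
by rewrite coord4E; field; rewrite gt_eqF.
Qed.

Lemma square_abs_regularization z : 0 < radius2 z ->
  square_abs (regularization z) = radius2 z.
Proof.
move=> N0; have L0 := action_radius2 N0.
rewrite /square_abs dist_regularization // inv_action_regularization //.
by field; rewrite gt_eqF.
Qed.

Lemma lift_regularization z : 0 < radius2 z ->
  lc_lift (regularization z) (x1 z) (x2 z) = z.
Proof.
move=> N0; have L0 := action_radius2 N0.
have E : x1 z ^+ 2 + x2 z ^+ 2 != 0 by rewrite gt_eqF.
rewrite /lc_lift unrotated_regularization // inv_action_regularization //.
by apply: coord4P; rewrite !coord4E // /radius2; field; rewrite E gt_eqF.
Qed.

Lemma inv_action_gt0 z : 0 < kepler z -> 0 < inv_action z.
Proof. by move=> k0; rewrite invr_gt0 sqrtr_gt0. Qed.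

Lemma inv_actionV2 z : 0 < kepler z -> inv_action z ^- 2 = kepler z.
Proof. by move=> k0; rewrite exprVn invrK sqr_sqrtr // ltW. Qed.

Lemma square_absE z :
  square_abs z ^+ 2 = square1 z ^+ 2 + square2 z ^+ 2.
Proof.
rewrite /square_abs /square1 /square2 !expr_div_n !exprMn -mulrDl -mulrDr.
rewrite -[x1 _ ^+ 2 + _]/(radius2 (unrotated z)) radius2_rotate /dist sqr_sqrtr //.
by rewrite addr_ge0 ?sqr_ge0.
Qed.

(** For each square root a + i b of x^2 the lift is a preimage. First
|x|^2 = 2 |q| / L gives back the value of L; then <x, y> = 2 <q, p> gives back
the angle t, and rotating by t undoes the rotation by - t. *)
Lemma lift_spec z a b : 0 < radius2 z -> 0 < kepler z ->
  a ^+ 2 - b ^+ 2 = square1 z -> 2 * a * b = square2 z ->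
  [/\ 0 < radius2 (lc_lift z a b), action (lc_lift z a b) = inv_action z,
      angmom (lc_lift z a b) = 2 * angmom z & regularization (lc_lift z a b) = z].
Proof.
move=> r0 k0 ab1 ab2; have l0 := inv_action_gt0 k0.
have d0 : 0 < dist z by rewrite sqrtr_gt0.
have N : a ^+ 2 + b ^+ 2 = square_abs z.
  apply/eqP; rewrite -(@eqrXn2 _ 2) ?addr_ge0 ?sqr_ge0 //; last first.
    by rewrite divr_ge0 ?mulr_ge0 // ltW.
  by rewrite square_absE -ab1 -ab2; apply/eqP; ring.
have N0 : 0 < a ^+ 2 + b ^+ 2 by rewrite N divr_gt0 ?mulr_gt0.
have rl : radius2 (lc_lift z a b) = a ^+ 2 + b ^+ 2 by rewrite /radius2 !coord4E.
have L : action (lc_lift z a b) = inv_action z.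
  rewrite (_ : action _ = (a ^+ 2 + b ^+ 2) * (1 + inv_action z ^+ 2 *
     mom2 (unrotated z)) / 4); last first.
    by rewrite /action /mom2 !coord4E; field.
  rewrite mom2_rotate (_ : mom2 z = 2 / dist z - inv_action z ^- 2).
    by rewrite N /square_abs; field; rewrite !gt_eqF.
  by rewrite inv_actionV2 // /kepler; ring.
have hP : y1 (unrotated z) * (a ^+ 2 - b ^+ 2) + y2 (unrotated z) * (2 * a * b)
    = 2 * qp z / inv_action z.
  rewrite ab1 ab2 -(qp_rotate (- inv_angle z) z) -/(unrotated z).
  by rewrite /square1 /square2 /qp; field; rewrite gt_eqF.
have hJ : y2 (unrotated z) * (a ^+ 2 - b ^+ 2) - y1 (unrotated z) * (2 * a * b)
    = 4 * angmom z / inv_action z.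
  rewrite ab1 ab2 -(angmom_rotate (- inv_angle z) z) -/(unrotated z).
  by rewrite /square1 /square2 /angmom; field; rewrite gt_eqF.
have angle : lc_angle (lc_lift z a b) = inv_angle z.
  rewrite /lc_angle L (_ : qp _ = inv_action z *
    (y1 (unrotated z) * (a ^+ 2 - b ^+ 2) + y2 (unrotated z) * (2 * a * b))).
    by rewrite hP /inv_angle; field; rewrite gt_eqF.
  by rewrite /qp !coord4E; ring.
split; rewrite ?rl //.
  rewrite (_ : angmom _ = inv_action z *
    (y2 (unrotated z) * (a ^+ 2 - b ^+ 2) - y1 (unrotated z) * (2 * a * b)) / 2).
    by rewrite hJ; field; rewrite gt_eqF.
  by rewrite /angmom !coord4E; field.
rewrite /regularization angle.
suff -> : scaled_lc (lc_lift z a b) = unrotated z by rewrite rotateNK.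
clear hP hJ angle; rewrite /lc_lift /square1 /square2 in ab1 ab2 L rl *.
move: (unrotated z) ab1 ab2 L rl => w ab1 ab2 L rl.
apply: coord4P; rewrite /scaled_lc L rl !coord4E.
- by rewrite ab1; field; rewrite gt_eqF.
- rewrite (_ : _ * (a * b) = inv_action z / 2 * (2 * a * b)); last by field.
  by rewrite ab2; field; rewrite gt_eqF.
- by field; rewrite (gt_eqF l0) (gt_eqF N0).
- by field; rewrite (gt_eqF l0) (gt_eqF N0).
Qed.

End Regularization.

(** * Preimages and sheets *)

Lemma card_pair (T : choiceType) (z w : T) (A : set T) : z != w ->
  A = [set z; w] -> (A #= `I_2)%card.
Proof.
move=> zw ->; apply/card_set_bijP; exists (fun u => if u == z then 0%N else 1%N).
split.
- by move=> u _ /=; case: ifP.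
- move=> u v; rewrite !inE => -[->|->] [->|->] //=; rewrite ?eqxx;
    by rewrite eq_sym (negPf zw).
- move=> [|[|//]] _; first by exists z => /=; [left|rewrite eqxx].
  by exists w => /=; [right|rewrite eq_sym (negPf zw)].
Qed.

(** Half the argument and the square root of the modulus. *)
Lemma complex_sqrt (R : realType) (s t : R) :
  exists a b, a ^+ 2 - b ^+ 2 = s /\ 2 * a * b = t.
Proof.
have [phi [hs ht]] := polar_angle s t.
set r := Num.sqrt _ in hs ht; have r0 : 0 <= r by exact: sqrtr_ge0.
exists (Num.sqrt r * cos (phi / 2)), (Num.sqrt r * sin (phi / 2)).
have phiE : phi = phi / 2 + phi / 2 by field.
split.
  rewrite !exprMn sqr_sqrtr // -mulrBr [RHS]hs {3}phiE cosD !expr2 //.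
rewrite (_ : 2 * _ * _ = Num.sqrt r ^+ 2 * (sin (phi / 2) * cos (phi / 2)
   + cos (phi / 2) * sin (phi / 2))); last by ring.
by rewrite sqr_sqrtr // -sinD -phiE.
Qed.

Section Covering.
Variables (R : realType).
Local Notation R4 := 'rV[R]_(2 + 2).
Implicit Types (z : R4) (a b C c : R).

Lemma radius2_gt0 z : (0 < radius2 z) = (pos z != 0).
Proof.
by rewrite lt_neqAle addr_ge0 ?sqr_ge0 // andbT eq_sym radius2_eq0.
Qed.

Definition punctured C : set R4 := regularized_surface C `\` collisions C.

Lemma puncturedP C z : punctured C z <-> regularized_surface C z /\ 0 < radius2 z.
Proof.
rewrite radius2_gt0; split=> [[Sz nC]|[Sz /eqP nz]].
  by split=> //; apply/eqP => h; apply: nC.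
by split=> // -[_].
Qed.

(** The cross term of the Hamiltonian is minus the angular momentum
q1 p2 - q2 p1, which is [2 * angmom z] because of the factor 1/2 in
[angmom]. *)
Lemma hamiltonian_kepler z : hamiltonian z = - (kepler z / 2) - 2 * angmom z.
Proof.
rewrite hamiltonianE enorm_pos /kepler /dist /mom2 /radius2.
by move: (Num.sqrt _)^-1 => e; field.
Qed.

Lemma angmom_dist z : 0 < radius2 z ->
  (2 * angmom z) ^+ 2 <= 2 * dist z - kepler z * dist z ^+ 2.
Proof.
move=> r0; have d0 : 0 < dist z by rewrite sqrtr_gt0.
rewrite [leRHS](_ : _ = radius2 z * mom2 z).
  rewrite -subr_ge0 (_ : _ - _ = qp z ^+ 2) ?sqr_ge0 //.
  by rewrite /radius2 /mom2 /angmom /qp; field.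
rewrite /kepler -[radius2 z]sqr_sqrtr ?ltW // -/(dist z).
by field; rewrite gt_eqF.
Qed.

Lemma energy_surface_kepler c z : c < - (3 / 2) ->
  bounded_energy_surface c z <->
  [/\ 0 < radius2 z, 1 < kepler z & 2 * angmom z = - c - kepler z / 2].
Proof.
move=> hc; apply: (iff_trans (bounded_energy_surfaceP _ hc)).
rewrite hamiltonian_kepler enorm_pos -radius2_gt0 -/(radius2 z) -/(dist z).
have hC : 3 / 2 < - c by lra.
split=> [[r0 H d1]|[r0 k1 H]].
  have hJ : 2 * angmom z = - c - kepler z / 2 by lra.
  split=> //; rewrite -(radius_lt1 hC hJ _ (angmom_dist r0)) //.
  by rewrite sqrtr_gt0.
split=> //; first by lra.
by rewrite (radius_lt1 hC H _ (angmom_dist r0)) // sqrtr_gt0.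
Qed.

Lemma regularization_energy c z : c < - (3 / 2) -> punctured (- c) z ->
  bounded_energy_surface c (regularization z).
Proof.
move=> hc /puncturedP [Sz r0]; have L0 := action_radius2 r0.
apply/(energy_surface_kepler _ hc); rewrite kepler_regularization //.
rewrite radius2_rotate radius2_lc angmom_rotate angmom_lc //; split.
- by rewrite exprn_gt0 // divr_gt0 // mulr_gt0.
- by rewrite invf_gt1 ?exprn_gt0 // exprn_ilt1 ?action_ge0 //; case: Sz.
- by rewrite -(surfaceE Sz); field.
Qed.

Lemma lift_punctured c z a b : c < - (3 / 2) -> bounded_energy_surface c z ->
  a ^+ 2 - b ^+ 2 = square1 z -> 2 * a * b = square2 z ->
  punctured (- c) (lc_lift z a b) /\ regularization (lc_lift z a b) = z.
Proof.
move=> hc /(energy_surface_kepler _ hc) [r0 k1 H] ab1 ab2.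
have k0 : 0 < kepler z by exact: lt_trans k1.
have [rl L J ->] := lift_spec r0 k0 ab1 ab2.
split=> //; apply/puncturedP; split=> //.
have L0 := inv_action_gt0 k0.
apply: surfaceP; rewrite L //.
  by rewrite invf_lt1 ?sqrtr_gt0 // -[1]sqrtr1 ltr_sqrt.
by rewrite J inv_actionV2.
Qed.

(** The two lifts come from the two square roots of x^2. They differ because x is
not 0, and there are no others because x determines y. *)
Lemma regularization_two_to_one c : c < - (3 / 2) ->
  two_to_one (punctured (- c) : set 'rV[R]_3.+1) (bounded_energy_surface c) (@regularization R).
Proof.
move=> hc y Ny.
have [a [b [ab1 ab2]]] := complex_sqrt (square1 y) (square2 y).
have [Pz fz] := lift_punctured hc Ny ab1 ab2.
have nab1 : (- a) ^+ 2 - (- b) ^+ 2 = square1 y by rewrite !sqrrN.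
have nab2 : 2 * (- a) * (- b) = square2 y by rewrite !(mulrN, mulNr) opprK.
have [Pw fw] := lift_punctured hc Ny nab1 nab2.
apply: (@card_pair _ (lc_lift y a b) (lc_lift y (- a) (- b))).
  apply/eqP => h; have /puncturedP [_] := Pz.
  have := congr1 (@x1 R) h; have := congr1 (@x2 R) h.
  rewrite /radius2 !coord4E => hb ha.
  have -> : a = 0 by lra.
  have -> : b = 0 by lra.
  by rewrite expr0n addr0 ltxx.
apply/seteqP; split=> z; last by move=> [->|->].
move=> [/puncturedP [_ r0] /= fzy].
have lz := lift_regularization r0; rewrite fzy in lz.
have e1 := square1_regularization r0; have e2 := square2_regularization r0.
rewrite fzy -ab1 in e1; rewrite fzy -ab2 in e2.
(* |x - s|^2 |x + s|^2 = |x^2 - s^2|^2 for complex numbers x and s = a + i b *)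
have : ((x1 z - a) ^+ 2 + (x2 z - b) ^+ 2) * ((x1 z + a) ^+ 2 + (x2 z + b) ^+ 2) = 0.
  rewrite (_ : _ * _ = ((x1 z ^+ 2 - x2 z ^+ 2) - (a ^+ 2 - b ^+ 2)) ^+ 2 +
    (2 * x1 z * x2 z - 2 * a * b) ^+ 2); last by ring.
  by rewrite e1 e2 !subrr expr0n addr0.
move=> /eqP; rewrite mulf_eq0 !paddr_eq0 ?sqr_ge0 // !sqrf_eq0 !subr_eq0 !addr_eq0.
by case/orP => /andP[/eqP ha /eqP hb]; [left|right]; rewrite /= -lz ha hb.
Qed.

Lemma open_smooth_gt0 (U : set R4) (f : R4 -> R) : open U -> smooth_on U f ->
  open (U `&` [set z | 0 < f z]).
Proof.
move=> oU sf; rewrite openE => z [Uz fz]; apply: filterI.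
  exact: open_nbhs_nbhs.
by have := smooth_continuous sf Uz; move/cvgr_gt; exact.
Qed.

Definition noncollision : set R4 := setT `&` [set z | 0 < radius2 z].

Lemma noncollision_open : open noncollision.
Proof. by apply: open_smooth_gt0; [exact: openT|exact/smooth_radius2/openT]. Qed.

Lemma smooth_qp (U : set R4) : open U -> smooth_on U (@qp R).
Proof.
move=> oU; apply: smoothD => //; apply: smoothM => //.
- exact: smooth_x1.
- exact: smooth_y1.
- exact: smooth_x2.
- exact: smooth_y2.
Qed.

Lemma smooth_mom2 (U : set R4) : open U -> smooth_on U (@mom2 R).
Proof.
move=> oU; apply: smoothD => //; apply: smoothX => //.
  exact: smooth_y1.
exact: smooth_y2.
Qed.

Lemma smooth_rotate (U : set R4) (t : R4 -> R) (f : R4 -> R4) : open U ->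
  smooth_on U t -> smooth_on U (fun z => x1 (f z)) -> smooth_on U (fun z => x2 (f z)) ->
  smooth_on U (fun z => y1 (f z)) -> smooth_on U (fun z => y2 (f z)) ->
  smooth_on U (fun z => rotate (t z) (f z)).
Proof.
move=> oU st sa sb sc sd.
have sco := smooth_cos oU st; have ssi := smooth_sin oU st.
by apply: smooth_coord4 => //; apply: smoothD => //; do ?apply: smoothN => //;
  apply: smoothM.
Qed.

Lemma smooth_regularization : smooth_on noncollision (@regularization R).
Proof.
have oU := noncollision_open.
have sa := smooth_x1 oU; have sb := smooth_x2 oU.
have sc := smooth_y1 oU; have sd := smooth_y2 oU.
have sL := smooth_action oU; have sr := smooth_radius2 oU.
have sLr : smooth_on noncollision (fun z => (action z * radius2 z)^-1).
  apply: smoothV => //; last exact: smoothM.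
  by move=> z [_ r0]; rewrite gt_eqF // mulr_gt0 // action_radius2.
have s2 : smooth_on noncollision (fun z : R4 => 2^-1 : R) by exact: smooth_cst.
apply: smooth_rotate => //.
- apply: smoothM => //; apply: smoothM => //; last exact: smooth_qp.
  exact: smoothX.
- apply: (smooth_eq oU) (_ : smooth_on _ (fun z => action z / 2 * (x1 z ^+ 2 - x2 z ^+ 2))).
    by move=> z _; rewrite coord4E.
  apply: smoothM => //; first exact: smoothM.
  by apply: smoothD => //; do ?apply: smoothN => //; apply: smoothX.
- apply: (smooth_eq oU) (_ : smooth_on _ (fun z => action z * (x1 z * x2 z))).
    by move=> z _; rewrite coord4E.
  by apply: smoothM => //; apply: smoothM.
- apply: (smooth_eq oU) (_ : smooth_on _ (fun z => (y1 z * x1 z - y2 z * x2 z) / (action z * radius2 z))).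
    by move=> z _; rewrite coord4E.
  by apply: smoothM => //; apply: smoothD => //; do ?apply: smoothN => //; apply: smoothM.
- apply: (smooth_eq oU) (_ : smooth_on _ (fun z => (y1 z * x2 z + y2 z * x1 z) / (action z * radius2 z))).
    by move=> z _; rewrite coord4E.
  by apply: smoothM => //; apply: smoothD => //; apply: smoothM.
Qed.

Definition elliptic : set R4 := noncollision `&` [set z | 0 < kepler z].

Lemma smooth_dist : smooth_on noncollision (@dist R).
Proof.
have oU := noncollision_open.
by apply: smooth_sqrt => //; [move=> z []|exact: smooth_radius2].
Qed.

Lemma smooth_kepler : smooth_on noncollision (@kepler R).
Proof.
have oU := noncollision_open.
apply: smoothD => //; last by apply: smoothN => //; exact: smooth_mom2.
apply: smoothM => //; first exact: smooth_cst.
apply: smoothV => //; last exact: smooth_dist.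
by move=> z [_ r0]; rewrite gt_eqF // sqrtr_gt0.
Qed.

Lemma elliptic_open : open elliptic.
Proof. exact: open_smooth_gt0 noncollision_open smooth_kepler. Qed.

Lemma smooth_subset (V W : normedModType R) (A B : set V) (f : V -> W) :
  A `<=` B -> smooth_on B f -> smooth_on A f.
Proof.
move=> AB sf k; elim: k f {sf}(sf k) => [|k IH] f /=.
  by move=> cf x Ax; exact/cf/AB.
by move=> [df Cf]; split=> [x Ax|v]; [exact/df/AB|exact/IH/Cf].
Qed.

(** For x0 = a + i b this is 2 (|x^2| |x0|^2 + Re (x^2 conj(x0)^2)), the square of
2 <x, x0>: it vanishes where x^2 lies on the negative multiples of x0^2, on
which the branches of the square root are cut. *)
Definition disc a b z :=
  2 * (square_abs z * (a ^+ 2 + b ^+ 2) + square1 z * (a ^+ 2 - b ^+ 2)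
       + square2 z * (2 * a * b)).
(** The real part of (x^2 conj(x0) + |x|^2 x0) / (2 <x, x0>), which is x because
x conj(x0) + conj(x) x0 = 2 <x, x0>. *)
Definition branch1 a b z :=
  (square1 z * a + square2 z * b + square_abs z * a) / Num.sqrt (disc a b z).
Definition branch2 a b z :=
  (square2 z * a - square1 z * b + square_abs z * b) / Num.sqrt (disc a b z).

Definition sheet_image a b : set R4 := elliptic `&` [set z | 0 < disc a b z].
Definition sheet a b : set R4 := [set z | 0 < x1 z * a + x2 z * b].
Definition local_inverse a b z := lc_lift z (branch1 a b z) (branch2 a b z).

Lemma branch_spec a b z : sheet_image a b z ->
  [/\ branch1 a b z ^+ 2 - branch2 a b z ^+ 2 = square1 z,
      2 * branch1 a b z * branch2 a b z = square2 z &
      0 < branch1 a b z * a + branch2 a b z * b].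
Proof.
move=> [_ /= D0]; have h := square_absE z.
have s0 : 0 < Num.sqrt (disc a b z) by rewrite sqrtr_gt0.
have s2 : Num.sqrt (disc a b z) ^+ 2 = disc a b z by rewrite sqr_sqrtr // ltW.
split.
- rewrite /branch1 /branch2 !expr_div_n s2 -mulrBl.
  rewrite (_ : _ - _ = square1 z * disc a b z + (square_abs z ^+ 2 -
     (square1 z ^+ 2 + square2 z ^+ 2)) * (a ^+ 2 - b ^+ 2)).
    by rewrite h subrr mul0r addr0 mulfK // gt_eqF.
  by rewrite /disc; ring.
- rewrite /branch1 /branch2.
  move: (Num.sqrt _) s0 s2 => s s0 s2.
  rewrite (_ : 2 * _ * _ = 2 * (square1 z * a + square2 z * b + square_abs z * a) *
    (square2 z * a - square1 z * b + square_abs z * b) / s ^+ 2).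
    rewrite s2; apply: (mulIf (lt0r_neq0 D0)); rewrite divfK ?gt_eqF //.
    rewrite /= -[RHS]addr0 -(mul0r (2 * a * b)) -(subrr (square_abs z ^+ 2)) {2}h.
    by rewrite /disc; ring.
  by field; rewrite gt_eqF.
- rewrite /branch1 /branch2.
  move: (Num.sqrt _) s0 => s s0.
  rewrite (_ : _ * a + _ * b = disc a b z / 2 / s).
    by rewrite !divr_gt0.
  by rewrite /disc; field; rewrite gt_eqF.
Qed.

Lemma disc_regularization a b z : 0 < radius2 z ->
  disc a b (regularization z) = (2 * (x1 z * a + x2 z * b)) ^+ 2.
Proof.
move=> r0; rewrite /disc square_abs_regularization // square1_regularization //.
by rewrite square2_regularization // /radius2; ring.
Qed.

Lemma local_inverse_regularization a b z : 0 < radius2 z -> sheet a b z ->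
  local_inverse a b (regularization z) = z.
Proof.
move=> r0 sz; rewrite /local_inverse.
have s0 : 0 < 2 * (x1 z * a + x2 z * b) by rewrite mulr_gt0.
have sD : Num.sqrt (disc a b (regularization z)) = 2 * (x1 z * a + x2 z * b).
  by rewrite disc_regularization // sqrtr_sqr gtr0_norm.
rewrite [branch1 _ _ _](_ : _ = x1 z); last first.
  rewrite /branch1 sD square_abs_regularization // square1_regularization //.
  rewrite square2_regularization //; apply: (mulIf (lt0r_neq0 s0)).
  by rewrite divfK ?gt_eqF // /radius2; ring.
rewrite [branch2 _ _ _](_ : _ = x2 z); last first.
  rewrite /branch2 sD square_abs_regularization // square1_regularization //.
  rewrite square2_regularization //; apply: (mulIf (lt0r_neq0 s0)).
  by rewrite divfK ?gt_eqF // /radius2; ring.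
exact: lift_regularization.
Qed.

End Covering.

(** * The smooth double covering *)

Section SmoothCovering.
Variables (R : realType).
Local Notation R4 := 'rV[R]_(2 + 2).
Implicit Types (z : R4) (a b C c : R).

Lemma smooth_mapW n (U A : set 'rV[R]_n.+1) (f : 'rV[R]_n.+1 -> 'rV[R]_n.+1) :
  open U -> A `<=` U -> smooth_on U f -> smooth_map A f.
Proof. by move=> oU AU sf x Ax; exists U, f; split=> //; exact: AU. Qed.

Lemma elliptic_noncollision : @elliptic R `<=` @noncollision R.
Proof. by move=> z []. Qed.

Lemma smooth_inv_action : smooth_on (@elliptic R) (@inv_action R).
Proof.
have oU := @elliptic_open R.
apply: smoothV => //; first by move=> z [_ k0]; rewrite gt_eqF // sqrtr_gt0.
apply: smooth_sqrt => //; first by move=> z [].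
exact: smooth_subset elliptic_noncollision (@smooth_kepler R).
Qed.

Lemma smooth_unrotated :
  [/\ smooth_on (@elliptic R) (fun z => x1 (unrotated z)),
      smooth_on (@elliptic R) (fun z => x2 (unrotated z)),
      smooth_on (@elliptic R) (fun z => y1 (unrotated z)) &
      smooth_on (@elliptic R) (fun z => y2 (unrotated z))].
Proof.
have oU := @elliptic_open R.
have sa := smooth_x1 oU; have sb := smooth_x2 oU.
have sc := smooth_y1 oU; have sd := smooth_y2 oU.
have st : smooth_on (@elliptic R) (fun z => - inv_angle z).
  apply: smoothN => //; apply: smoothM => //; last exact: smooth_qp.
  by apply: smoothX => //; exact: smooth_inv_action.
have sco := smooth_cos oU st; have ssi := smooth_sin oU st.
split.
- apply: (smooth_eq oU) (_ : smooth_on _ (fun z => cos (- inv_angle z) * x1 z - sin (- inv_angle z) * x2 z)).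
    by move=> z _; rewrite x1_coord4.
  by apply: smoothD => //; do ?apply: smoothN => //; apply: smoothM.
- apply: (smooth_eq oU) (_ : smooth_on _ (fun z => sin (- inv_angle z) * x1 z + cos (- inv_angle z) * x2 z)).
    by move=> z _; rewrite x2_coord4.
  by apply: smoothD => //; apply: smoothM.
- apply: (smooth_eq oU) (_ : smooth_on _ (fun z => cos (- inv_angle z) * y1 z - sin (- inv_angle z) * y2 z)).
    by move=> z _; rewrite y1_coord4.
  by apply: smoothD => //; do ?apply: smoothN => //; apply: smoothM.
- apply: (smooth_eq oU) (_ : smooth_on _ (fun z => sin (- inv_angle z) * y1 z + cos (- inv_angle z) * y2 z)).
    by move=> z _; rewrite y2_coord4.
  by apply: smoothD => //; apply: smoothM.
Qed.

Lemma smooth_squares :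
  [/\ smooth_on (@elliptic R) (@square1 R), smooth_on (@elliptic R) (@square2 R) &
      smooth_on (@elliptic R) (@square_abs R)].
Proof.
have oU := @elliptic_open R.
have [sa sb _ _] := smooth_unrotated.
have si : smooth_on (@elliptic R) (fun z => (inv_action z)^-1).
  apply: smoothV => //; last exact: smooth_inv_action.
  by move=> z [_ k0]; rewrite gt_eqF // inv_action_gt0.
have s2 : smooth_on (@elliptic R) (fun z : R4 => 2 : R) by exact: smooth_cst.
split; apply: smoothM => //; apply: smoothM => //.
exact: smooth_subset elliptic_noncollision (@smooth_dist R).
Qed.

Lemma smooth_disc a b : smooth_on (@elliptic R) (disc a b).
Proof.
have oU := @elliptic_open R; have [s1 s2 s3] := smooth_squares.
have sc (t : R) : smooth_on (@elliptic R) (fun z : R4 => t) by exact: smooth_cst.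
apply: smoothM => //; apply: smoothD => //; last exact: smoothM.
by apply: smoothD => //; exact: smoothM.
Qed.

Lemma sheet_image_open a b : open (@sheet_image R a b).
Proof. exact: open_smooth_gt0 (@elliptic_open R) (smooth_disc a b). Qed.

Lemma smooth_local_inverse a b : smooth_on (sheet_image a b) (@local_inverse R a b).
Proof.
have oU := @sheet_image_open a b.
have sub : @sheet_image R a b `<=` @elliptic R by move=> z [].
have [t1 t2 t3 t4] := smooth_unrotated; have [q1 q2 q3] := smooth_squares.
have s1 := smooth_subset sub q1; have s2 := smooth_subset sub q2.
have s3 := smooth_subset sub q3; have si := smooth_subset sub smooth_inv_action.
have u3 := smooth_subset sub t3; have u4 := smooth_subset sub t4.
have sc (t : R) : smooth_on (sheet_image a b) (fun z : R4 => t) by exact: smooth_cst.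
have sD : smooth_on (sheet_image a b) (fun z => (Num.sqrt (disc a b z))^-1).
  apply: smoothV => //; first by move=> z [_ /= D0]; rewrite gt_eqF // sqrtr_gt0.
  by apply: smooth_sqrt => //; [move=> z []|exact: smooth_subset sub (smooth_disc a b)].
have r1 : smooth_on (sheet_image a b) (branch1 a b).
  apply: smoothM => //; apply: smoothD => //; last exact: smoothM.
  by apply: smoothD => //; exact: smoothM.
have r2 : smooth_on (sheet_image a b) (branch2 a b).
  apply: smoothM => //; apply: smoothD => //; last exact: smoothM.
  by apply: smoothD => //; do ?apply: smoothN => //; exact: smoothM.
apply: smooth_coord4 => //; apply: smoothM => //; apply: smoothD => //;
  do ?apply: smoothN => //; exact: smoothM.
Qed.

Lemma sheet_open a b : open (@sheet R a b).
Proof.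
have sa := smooth_x1 (@openT R4); have sb := smooth_x2 (@openT R4).
rewrite /sheet -[X in open X]setTI; apply: open_smooth_gt0; first exact: openT.
apply: smoothD; first exact: openT.
  by apply: smoothM => //; [exact: openT|exact/smooth_cst/openT].
by apply: smoothM => //; [exact: openT|exact/smooth_cst/openT].
Qed.

(** The half-space <x, x0> > 0 selects one of the two square roots of x^2, and the
corresponding branch gives the smooth inverse. *)
Lemma sheet_diffeomorphism c a b : c < - (3 / 2) ->
  diffeomorphism (punctured (- c) `&` sheet a b : set 'rV[R]_3.+1)
    (bounded_energy_surface c `&` sheet_image a b) (@regularization R).
Proof.
move=> hc.
have gf z : (punctured (- c) `&` sheet a b) z ->
    local_inverse a b (regularization z) = z.
  by move=> [/puncturedP [_ r0] sz]; exact: local_inverse_regularization.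
split.
- split.
  + move=> z [Pz sz]; have /puncturedP [_ r0] := Pz.
    have L0 := action_radius2 r0.
    split; first exact: regularization_energy.
    split; first split.
    * split=> //=; rewrite radius2_rotate radius2_lc.
      by rewrite exprn_gt0 // divr_gt0 // mulr_gt0.
    * by rewrite /= kepler_regularization // invr_gt0 exprn_gt0.
    * by rewrite /= disc_regularization // exprn_gt0 // mulr_gt0.
  + by move=> z w /set_mem Pz /set_mem Pw h; rewrite -(gf z Pz) -(gf w Pw) h.
  + move=> y [Ny sy]; have [r1 r2 r3] := branch_spec sy.
    have [Pz fz] := lift_punctured hc Ny r1 r2.
    exists (local_inverse a b y) => //; split=> //.
    by rewrite /sheet /= /local_inverse /lc_lift !coord4E.
- apply: (smooth_mapW (@noncollision_open R)); last exact: smooth_regularization.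
  by move=> z [/puncturedP [_ r0] _].
- exists (local_inverse a b); last by move=> z /gf.
  apply: (smooth_mapW (@sheet_image_open a b)); last exact: smooth_local_inverse.
  by move=> y [].
Qed.

Lemma sheet_imageN a b : @sheet_image R (- a) (- b) = sheet_image a b.
Proof.
by congr (_ `&` _); apply/seteqP; split=> z /=;
  rewrite /disc !sqrrN !(mulrN, mulNr) opprK.
Qed.

(** Around y the square root x0 of its own x^2 serves as the direction of the
branches: the sheets are the half-spaces <x, x0> > 0 and <x, - x0> > 0. *)
Lemma regularization_covering c : c < - (3 / 2) ->
  smooth_covering (punctured (- c) : set 'rV[R]_3.+1)
    (bounded_energy_surface c) (@regularization R).
Proof.
move=> hc; split.
- apply: (smooth_mapW (@noncollision_open R)); last exact: smooth_regularization.
  by move=> z /puncturedP [_ r0].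
- move=> y Ny; have [a [b [ab1 ab2]]] := complex_sqrt (square1 y) (square2 y).
  by have [Pz fz] := lift_punctured hc Ny ab1 ab2; exists (lc_lift y a b).
- by move=> z Pz; exact: regularization_energy.
move=> y Ny; have [a [b [ab1 ab2]]] := complex_sqrt (square1 y) (square2 y).
have [Pz fz] := lift_punctured hc Ny ab1 ab2.
have [r0 k1 _] := (energy_surface_kepler _ hc).1 Ny.
exists (sheet_image a b), bool, (fun e => if e then sheet a b else sheet (- a) (- b)).
split.
- split; first exact: sheet_image_open.
  split; first by split=> //=; exact: lt_trans k1.
  have /puncturedP [_ rz] := Pz.
  have := disc_regularization a b rz; rewrite fz /= => ->.
  move: rz; rewrite /radius2 !coord4E !expr2 => rz.
  by rewrite mulr_gt0 // mulr_gt0.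
- by case; exact: sheet_open.
- apply/seteqP; split=> z.
    move=> [Pw [_ /=]]; have /puncturedP [_ rw] := Pw.
    rewrite disc_regularization // => D0.
    have [s0|s0] := ltP 0 (x1 z * a + x2 z * b); first by exists true.
    exists false => //; split=> //; rewrite /sheet /= !mulrN -opprD oppr_gt0.
    rewrite lt_neqAle s0 andbT; apply: contraTneq D0 => ->.
    by rewrite mulr0 expr0n ltxx.
  move=> [[] _ [Pw sw]]; split=> //.
    have [[ff _ _] _ _] := sheet_diffeomorphism a b hc.
    by have [] := ff z (conj Pw sw).
  have [[ff _ _] _ _] := sheet_diffeomorphism (- a) (- b) hc.
  by have [_] := ff z (conj Pw sw); rewrite sheet_imageN.
- move=> [] [] // _ _ [z [[_ /= h1] [_ /= h2]]];
    move: h1 h2; rewrite /sheet /= !mulrN -opprD oppr_gt0 => h1 h2;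
    by move: (lt_trans h1 h2); rewrite ltxx.
- case; first exact: sheet_diffeomorphism.
  by rewrite -(sheet_imageN a b); exact: sheet_diffeomorphism.
Qed.

(** |q| = L |x|^2 / 2 <= |x|^2. *)
Lemma regularization_collision C (x : nat -> R4) (a : R4) :
  (forall k, punctured C (x k)) -> collisions C a -> x @ \oo --> a ->
  (fun k => pos (regularization (x k))) @ \oo --> (0 : 'rV[R]_2).
Proof.
move=> Px [_ /= a0] xa.
have r_cvg : radius2 (x k) @[k --> \oo] --> (0 : R).
  have <- : radius2 a = 0 by apply/eqP; rewrite radius2_eq0 a0.
  apply: continuous_cvg xa.
  exact: smooth_continuous (smooth_radius2 openT) _.
have le_r k : `|pos (regularization (x k))| <= radius2 (x k).
  have /puncturedP [Sx r0] := Px k.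
  apply: le_trans (norm_le_enorm2 _) _.
  rewrite enorm_pos -/(radius2 _) -/(dist _) dist_regularization //.
  have L1 : action (x k) < 1 by case: Sx.
  by rewrite mulrAC ler_piMl //; [exact: ltW|lra].
apply/cvgr0Pnorm_lt => e e0.
move/cvgr0Pnorm_lt : r_cvg => /(_ e e0); apply: filterS => k.
by apply: le_lt_trans; rewrite ger0_norm ?le_r // addr_ge0 ?sqr_ge0.
Qed.

End SmoothCovering.

(** * Symplecticity *)

Section Symplectic.
Variables (R : realType).
Local Notation R4 := 'rV[R]_(2 + 2).
Implicit Types (z v w : R4) (C c : R).

Definition qp_polar z v := x1 z * y1 v + x1 v * y1 z + (x2 z * y2 v + x2 v * y2 z).

Definition dlc z v : R4 :=
  let L := action z in let N := radius2 z in let L' := action_polar z v in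
  let LN' := L' * N + L * (2 * (x1 z * x1 v + x2 z * x2 v)) in
  coord4 (L' / 2 * (x1 z ^+ 2 - x2 z ^+ 2) + L * (x1 z * x1 v - x2 z * x2 v))
    (L' * (x1 z * x2 z) + L * (x1 v * x2 z + x1 z * x2 v))
    ((y1 v * x1 z + y1 z * x1 v - y2 v * x2 z - y2 z * x2 v) / (L * N)
       - (y1 z * x1 z - y2 z * x2 z) * LN' / (L * N) ^+ 2)
    ((y1 v * x2 z + y1 z * x2 v + y2 v * x1 z + y2 z * x1 v) / (L * N)
       - (y1 z * x2 z + y2 z * x1 z) * LN' / (L * N) ^+ 2).

Definition dlc_angle z v :=
  action z * action_polar z v * qp z + action z ^+ 2 * qp_polar z v / 2.

(** The infinitesimal generator of the rotations. *)
Definition quarter_turn z : R4 := coord4 (- x2 z) (x1 z) (- y2 z) (y1 z).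

Lemma omega_rotate t z v : omega (rotate t z) (rotate t v) = omega z v.
Proof.
rewrite !omegaE /rotate !coord4E -[RHS]mul1r -[X in _ = X * _](cos2Dsin2 t).
ring.
Qed.

(** The product rule in the rotating frame: the derivative is rotated by the angle
t, and the motion of the frame contributes t' times the generator of the
rotations. *)
Lemma derive_regularization (gamma : R -> R4) (t : R) :
  derivable gamma t 1 -> 0 < radius2 (gamma t) ->
  let z := gamma t in let v := 'D_1 gamma t in
  'D_1 (@regularization R \o gamma) t =
  rotate (lc_angle z) (dlc z v + dlc_angle z v *: quarter_turn (scaled_lc z)).
Proof.
move=> dg r0 z v.
have L0 := action_radius2 r0.
have ha := dir_x1 dg; have hb := dir_x2 dg.
have hc := dir_y1 dg; have hd := dir_y2 dg; have hL := dir_action dg.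
rewrite -/z -/v in ha hb hc hd hL r0 L0.
have hr : is_derive t 1 (fun s => radius2 (gamma s)) (2 * (x1 z * x1 v + x2 z * x2 v)).
  by apply: is_derive_eq (dirD (dirX 2 ha) (dirX 2 hb)) _; rewrite /=; ring.
have hq : is_derive t 1 (fun s => qp (gamma s)) (qp_polar z v).
  apply: is_derive_eq (dirD (dirM ha hc) (dirM hb hd)) _.
  by rewrite /qp_polar -/z; ring.
have hLr : is_derive t 1 (fun s => (action (gamma s) * radius2 (gamma s))^-1)
    (- ((action_polar z v * radius2 z + action z * (2 * (x1 z * x1 v + x2 z * x2 v))) /
       (action z * radius2 z) ^+ 2)).
  by apply: dirV (dirM hL hr); rewrite mulf_neq0 // gt_eqF.
have ht : is_derive t 1 (fun s => lc_angle (gamma s)) (dlc_angle z v).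
  apply: is_derive_eq (dirM (dirM (dirX 2 hL) hq) (dirC 2^-1 t 1)) _.
  by rewrite /dlc_angle -/z /=; field.
have hu1 : is_derive t 1 (fun s => x1 (scaled_lc (gamma s))) (x1 (dlc z v)).
  under eq_fun do rewrite x1_coord4.
  apply: is_derive_eq (dirM (dirM hL (dirC 2^-1 t 1)) (dirD (dirX 2 ha) (dirN (dirX 2 hb)))) _.
  by rewrite x1_coord4 -/z /=; field.
have hu2 : is_derive t 1 (fun s => x2 (scaled_lc (gamma s))) (x2 (dlc z v)).
  under eq_fun do rewrite x2_coord4.
  apply: is_derive_eq (dirM hL (dirM ha hb)) _.
  by rewrite x2_coord4 -/z /=; ring.
have hw1 : is_derive t 1 (fun s => y1 (scaled_lc (gamma s))) (y1 (dlc z v)).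
  under eq_fun do rewrite y1_coord4.
  apply: is_derive_eq (dirM (dirD (dirM hc ha) (dirN (dirM hd hb))) hLr) _.
  by rewrite y1_coord4 -/z /=; ring.
have hw2 : is_derive t 1 (fun s => y2 (scaled_lc (gamma s))) (y2 (dlc z v)).
  under eq_fun do rewrite y2_coord4.
  apply: is_derive_eq (dirM (dirD (dirM hc hb) (dirM hd ha)) hLr) _.
  by rewrite y2_coord4 -/z /=; ring.
have hco := dir_cos ht; have hsi := dir_sin ht; rewrite -/z in hco hsi.
have := derive_coord4 (dirD (dirM hco hu1) (dirN (dirM hsi hu2)))
  (dirD (dirM hsi hu1) (dirM hco hu2)) (dirD (dirM hco hw1) (dirN (dirM hsi hw2)))
  (dirD (dirM hsi hw1) (dirM hco hw2)).
rewrite -/z => E; rewrite [LHS]E {E}.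
move: (dlc z v) (scaled_lc z) => w u.
by apply: coord4P; rewrite /rotate /quarter_turn !(coordDZ, coord4E); ring.
Qed.

Lemma angmom_polar_lc z v : 0 < radius2 z ->
  angmom_polar (scaled_lc z) (dlc z v) = angmom_polar z v / 2.
Proof.
move=> r0; have L0 := action_radius2 r0.
have E : x1 z ^+ 2 + x2 z ^+ 2 != 0 by rewrite gt_eqF.
rewrite /angmom_polar /scaled_lc /dlc !coord4E /radius2.
move: (action_polar z v) => L'; move: (action z) L0 => L L0.
by field; rewrite E gt_eqF.
Qed.

Lemma omega_lc z v w : 0 < radius2 z ->
  omega (dlc z v) (dlc z w) = omega v w
  + (qp_polar z v * action_polar z w - qp_polar z w * action_polar z v) / (2 * action z).
Proof.
move=> r0; have L0 := action_radius2 r0.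
have E : x1 z ^+ 2 + x2 z ^+ 2 != 0 by rewrite gt_eqF.
have := scaled_levi_civita_form (y1 z) (y2 z) (x1 v) (x2 v) (y1 v) (y2 v)
  (action_polar z v) (x1 w) (x2 w) (y1 w) (y2 w) (action_polar z w)
  (lt0r_neq0 L0) E.
move=> /= h.
transitivity (y1 (dlc z v) * x1 (dlc z w) + y2 (dlc z v) * x2 (dlc z w)
  - (x1 (dlc z v) * y1 (dlc z w) + x2 (dlc z v) * y2 (dlc z w))).
  by rewrite omegaE; ring.
rewrite !coord4E /radius2 h omegaE /qp_polar.
by field; rewrite gt_eqF.
Qed.

(** Differentiate J = C - 1 / (2 L^2). *)
Lemma tangent_polar C z v : regularized_surface C z -> denergy C z v = 0 ->
  angmom_polar z v = action_polar z v / action z ^+ 3.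
Proof.
move=> Sz dF0; have L0 := surface_action_gt0 Sz.
apply: (mulIf (lt0r_neq0 (exprn_gt0 2 L0))).
move: dF0; rewrite /denergy (surfaceE Sz) => /eqP; rewrite subr_eq0 => /eqP <-.
by field; rewrite gt_eqF.
Qed.

(** The generator of the rotations is dual to the angular momentum, which is J on
the source. The rotation thus contributes - dt /\ dJ = - dt /\ dL / L^3 on S,
and this cancels the contribution of the dilation. *)
Lemma regularization_symplectic C :
  symplectic_on (punctured C : set R4) (@regularization R).
Proof.
move=> z gamma delta Pz [g0 [I [oI I0 sg gP]]] [d0 [J [oJ J0 sd dP]]].
have [Sz r0] := (puncturedP _ _).1 Pz.
have L0 := action_radius2 r0.
have dg : derivable gamma 0 1 by apply/diff_derivable/smooth_differentiable.
have dd : derivable delta 0 1 by apply/diff_derivable/smooth_differentiable.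
have tg : denergy C z (derive1 gamma 0) = 0.
  apply: tangent_surface; exists gamma => //; split=> //.
  by exists I; split=> // t /gP [].
have td : denergy C z (derive1 delta 0) = 0.
  apply: tangent_surface; exists delta => //; split=> //.
  by exists J; split=> // t /dP [].
have eg := derive_regularization dg; have ed := derive_regularization dd.
rewrite g0 in eg; rewrite d0 in ed.
move: tg td; rewrite !derive1E (eg r0) (ed r0) => tg td.
move: ('D_1 gamma 0) tg ('D_1 delta 0) td => v tv w tw.
rewrite omega_rotate.
have expand : omega (dlc z v + dlc_angle z v *: quarter_turn (scaled_lc z))
    (dlc z w + dlc_angle z w *: quarter_turn (scaled_lc z)) =
  omega (dlc z v) (dlc z w)
  - dlc_angle z v * (2 * angmom_polar (scaled_lc z) (dlc z w))
  + dlc_angle z w * (2 * angmom_polar (scaled_lc z) (dlc z v)).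
  move: (dlc z v) (dlc z w) (scaled_lc z) => v' w' u.
  rewrite !omegaE /angmom_polar /quarter_turn !(coordDZ, coord4E).
  by field.
rewrite expand !angmom_polar_lc // (tangent_polar Sz tv) (tangent_polar Sz tw).
rewrite omega_lc // /dlc_angle; field.
by rewrite gt_eqF.
Qed.

End Symplectic.

Theorem theoremA (R : realType) (c : R) (hc : c < - (3 / 2)) :
  exists (S C : set 'rV[R]_(2 + 2)) (f : 'rV[R]_(2 + 2) -> 'rV[R]_(2 + 2)),
    [/\ closed_strictly_convex_hypersurface S,
        C `<=` S, closed C & nowhere_dense_in C S] /\
    [/\ smooth_covering (S `\` C) (bounded_energy_surface c) f,
        two_to_one (S `\` C) (bounded_energy_surface c) f,
        symplectic_on (S `\` C) f &
        forall (x : nat -> 'rV[R]_(2 + 2)) (a : 'rV[R]_(2 + 2)),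
          (forall k, (S `\` C) (x k)) -> C a -> x @ \oo --> a ->
          (fun k => pos (f (x k))) @ \oo --> (0 : 'rV[R]_2)].
Proof.
have hC : 3 / 2 < - c by lra.
exists (regularized_surface (- c)), (collisions (- c)), (@regularization R).
split; split.
- exact: surface_closed_strictly_convex.
- by move=> z [].
- exact: collisions_closed.
- exact: collisions_nowhere_dense.
- exact: regularization_covering.
- exact: regularization_two_to_one.
- exact: regularization_symplectic.
- by move=> x a; exact: regularization_collision.
Qed.
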